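(* Let $V_{AB}$ be a normal bipartite quantum covariance matrix (QCM). Then $$E^{G,\infty}_{\downarrow}(V_{AB}) = E^{G}_{\downarrow}(V_{AB}) = E^{G}_{F,2}(V_{AB}).$$ In particular, these equalities hold for all two-mode QCMs $V_{AB}$ (one mode on $A$ and one mode on $B$).
   Context: For an $m$-mode system, with phase-space coordinates ordered as $(x_1,\dots,x_m,p_1,\dots,p_m)$ and $\Omega=\begin{pmatrix}0&\mathbb 1\\-\mathbb 1&0\end{pmatrix}$, a QCM is a real symmetric $2m\times 2m$ matrix $V$ with $V\ge i\Omega$; it is pure iff $\det V=1$. A real matrix $S$ is symplectic if $S\Omega S^\intercal=\Omega$. For composite systems phase spaces and symplectic forms compose by direct sum ($\Omega_{AB}=\Omega_A\oplus\Omega_B$), and $V_A$, $V_{AE}$, etc. denote principal blocks. A bipartite QCM $V_{AB}$ is *normal* if there are symplectic matrices $S_A,S_B$ such that $(S_A\oplus S_B)V_{AB}(S_A\oplus S_B)^\intercal$ is in $xp$-form, i.e. all its entries between an $x$ coordinate and a $p$ coordinate (of any modes of $AB$) vanish. A purification of $V_{AB}$ is a pure QCM $\gamma_{ABE}$ (for some system $E$) whose $AB$ block is $V_{AB}$. For a positive definite matrix $W_{ABE}$ set $$I_M(A:B|E)_W=\tfrac12\log_2\frac{(\det W_{AE})(\det W_{BE})}{(\det W_E)(\det W_{ABE})}.$$ Gaussian intrinsic entanglement: with $\gamma_{ABE}$ any purification of $V_{AB}$ (the value does not depend on the choice), $$E^G_\downarrow(V_{AB})=\sup_{\Gamma_A,\Gamma_B}\inf_{\Gamma_E}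 I_M(A:B|E)_{\gamma_{ABE}+\Gamma_A\oplus\Gamma_B\oplus\Gamma_E},$$ where $\Gamma_A,\Gamma_B,\Gamma_E$ range over all QCMs on $A,B,E$. Its regularisation is $E^{G,\infty}_\downarrow(V_{AB})=\liminf_{n\to\infty}\frac1nE^G_\downarrow(V_{AB}^{\oplus n})$, with $V_{AB}^{\oplus n}$ regarded as a bipartite QCM of $A^n:B^n$. Rényi-$2$ Gaussian entanglement of formation: $E^{G}_{F,2}(V_{AB})=\inf\{\frac12\log_2\det\gamma_A:\ \gamma_{AB}\text{ a pure QCM},\ i\Omega_{AB}\le\gamma_{AB}\le V_{AB}\}$. *)

(* Defs.v *)
From mathcomp Require Import all_boot all_order all_algebra.
From mathcomp Require Import all_classical all_reals all_analysis.
From mathcomp Require Import complex mxtens.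

Set Implicit Arguments.
Unset Strict Implicit.
Unset Printing Implicit Defensive.

Import Order.TTheory GRing.Theory Num.Theory.

Local Open Scope classical_set_scope.
Local Open Scope ring_scope.

(* The phase space of an m-mode system is indexed by ['I_(m + m)], positions
   first and momenta second; that of a composite system AB by
   ['I_((a + a) + (b + b))], and that of ABE by
   ['I_(((a + a) + (b + b)) + (e + e))]. *)

Section QuantumCovarianceMatrices.
Context {R : realType}.

Definition dsum n1 n2 (M : 'M[R]_n1) (N : 'M[R]_n2) : 'M[R]_(n1 + n2) :=
  block_mx M 0 0 N.

Definition Omega m : 'M[R]_(m + m) := block_mx 0 1%:M (- 1%:M) 0.

Definition OmegaAB a b : 'M[R]_((a + a) + (b + b)) :=
  dsum (Omega a) (Omega b).

Definition OmegaABE a b e : 'M[R]_(((a + a) + (b + b)) + (e + e)) :=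
  dsum (OmegaAB a b) (Omega e).

Definition mxC n (M : 'M[R]_n) : 'M[R[i]]_n := map_mx (real_complex R) M.

(* The Loewner order. In [R[i]], [0 <= w] says that [w] is real and
   nonnegative. *)
Definition loewner_le n (M N : 'M[R[i]]_n) : Prop :=
  forall z : 'cV[R[i]]_n,
    0 <= ((map_mx Num.conj z)^T *m (N - M) *m z) 0 0.

(* These take the symplectic form as a parameter, so that they apply verbatim
   to single systems and to composite ones. *)
Definition qcm n (Om V : 'M[R]_n) : Prop :=
  V^T = V /\ loewner_le ('i%C *: mxC Om) (mxC V).

Definition pure_qcm n (Om V : 'M[R]_n) : Prop := qcm Om V /\ \det V = 1.

Definition symplectic n (Om S : 'M[R]_n) : Prop := S *m Om *m S^T = Om.

Definition no_xp_entries p q (M : 'M[R]_(p + p, q + q)) : Prop :=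
  ursubmx M = 0 /\ dlsubmx M = 0.

Definition xp_form a b (V : 'M[R]_((a + a) + (b + b))) : Prop :=
  [/\ no_xp_entries (ulsubmx V), no_xp_entries (ursubmx V),
      no_xp_entries (dlsubmx V) & no_xp_entries (drsubmx V)].

Definition normal_qcm a b (V : 'M[R]_((a + a) + (b + b))) : Prop :=
  qcm (OmegaAB a b) V /\
  exists (SA : 'M[R]_(a + a)) (SB : 'M[R]_(b + b)),
    [/\ symplectic (Omega a) SA, symplectic (Omega b) SB &
        xp_form (dsum SA SB *m V *m (dsum SA SB)^T)].

Definition purification a b e (V : 'M[R]_((a + a) + (b + b)))
    (g : 'M[R]_(((a + a) + (b + b)) + (e + e))) : Prop :=
  pure_qcm (OmegaABE a b e) g /\ ulsubmx g = V.

Definition log2 (x : R) : R := ln x / ln 2.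

Definition blockAE n1 n2 n3 (W : 'M[R]_((n1 + n2) + n3)) : 'M[R]_(n1 + n3) :=
  block_mx (ulsubmx (ulsubmx W)) (usubmx (ursubmx W))
           (lsubmx (dlsubmx W))  (drsubmx W).

Definition blockBE n1 n2 n3 (W : 'M[R]_((n1 + n2) + n3)) : 'M[R]_(n2 + n3) :=
  block_mx (drsubmx (ulsubmx W)) (dsubmx (ursubmx W))
           (rsubmx (dlsubmx W))  (drsubmx W).

Definition cond_mutual_info n1 n2 n3 (W : 'M[R]_((n1 + n2) + n3)) : R :=
  2^-1 * log2 ((\det (blockAE W) * \det (blockBE W)) /
               (\det (drsubmx W) * \det W)).

Definition intrinsic_value a b e
    (g : 'M[R]_(((a + a) + (b + b)) + (e + e))) : \bar R :=
  ereal_sup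
    [set ereal_inf
           [set (cond_mutual_info (g + dsum (dsum GA GB) GE))%:E
             | GE in qcm (Omega e)]
      | GA in qcm (Omega a) & GB in qcm (Omega b)].

(* The value at an arbitrarily picked purification, of any number of modes. *)
Definition intrinsic_ent a b (V : 'M[R]_((a + a) + (b + b))) : \bar R :=
  get [set x : \bar R |
        exists (e : nat) (g : 'M[R]_(((a + a) + (b + b)) + (e + e))),
          purification V g /\ x = intrinsic_value g].

(* The modes of [n] copies of an m-mode system are indexed by ['I_(n * m)],
   seen as pairs (copy, mode). The positions of all copies come before the
   momenta of all copies, and [1%:M *t M] is M repeated along the diagonal. *)
Definition copies_block n p q (M : 'M[R]_(p + p, q + q)) :
    'M[R]_(n * p + n * p, n * q + n * q) :=
  block_mx ((1%:M : 'M[R]_n) *t ulsubmx M) ((1%:M : 'M[R]_n) *t ursubmx M)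
           ((1%:M : 'M[R]_n) *t dlsubmx M) ((1%:M : 'M[R]_n) *t drsubmx M).

(* [n] copies of V, with the A-modes of all copies grouped before their
   B-modes. *)
Definition copies n a b (V : 'M[R]_((a + a) + (b + b))) :
    'M[R]_((n * a + n * a) + (n * b + n * b)) :=
  block_mx (copies_block n (ulsubmx V)) (copies_block n (ursubmx V))
           (copies_block n (dlsubmx V)) (copies_block n (drsubmx V)).

Definition reg_intrinsic_ent a b (V : 'M[R]_((a + a) + (b + b))) : \bar R :=
  limn_einf (fun n : nat => ((n%:R^-1)%:E * intrinsic_ent (copies n V))%E).

Definition renyi2_ent_formation a b (V : 'M[R]_((a + a) + (b + b))) : \bar R :=
  ereal_inf
    [set (2^-1 * log2 (\det (ulsubmx g)))%:E
      | g in [set g : 'M[R]_((a + a) + (b + b)) |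
               pure_qcm (OmegaAB a b) g /\ loewner_le (mxC g) (mxC V)]].

End QuantumCovarianceMatrices.

Arguments OmegaAB {R} a b.
Arguments Omega {R} m.

(* Main.v *)
Require Import Defs.
From mathcomp Require Import all_boot all_order all_algebra.
From mathcomp Require Import all_classical all_reals all_analysis.
From mathcomp Require Import complex mxtens ring lra.

(* All quantities are computed by a value attached to the position and momentum
   blocks [Q], [P] of an xp-form of [V]: the infimum, over the positive definite
   [K] with [P^-1 <= K <= Q], of the classical mutual information
   [I(K) = 1/2 log (det K_A det K_B / det K)].
   - If [K] is feasible then the pure state with blocks [K], [K^-1] lies below
     [V] and its reduced entropy is [I(K)], so the entanglement of formation is
     at most this infimum.
   - A measurement on the purifying system leaves [A B] in a state [W <= V] with
     feasible position block [K]; when [A] and [B] then measure positions with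
     small noise they see at least [I(K)] up to a small error, uniformly in [W].
   - Conversely, every pure [G <= V] is prepared, up to a small error, by some
     measurement on the purifying system, and no local measurements extract
     more than [1/2 log det G_A] from [G].
   For several copies, conditioning on one copy gives superadditivity of the
   infimum, hence its additivity and the statement on the regularisation. A
   two-mode state is normal because local symplectic transformations make its
   diagonal blocks scalar and local rotations then diagonalise the correlations. *)
Set Implicit Arguments.
Unset Strict Implicit.
Unset Printing Implicit Defensive.

Import Order.TTheory GRing.Theory Num.Theory.

Local Open Scope classical_set_scope.
Local Open Scope ring_scope.

(** * Positive semidefinite matrices *)

(** The extrema defining the intrinsic entanglement need not be attained: a noiseless position
    measurement, or one on E that prepares a boundary state [G <= V], is only a limit of QCMs.
    Conditioning on a measured system is a Schur complement, and the conditional mutual information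
    is the ordinary one of that complement. A conditioned state may have position-momentum
    correlations, but its momentum block still dominates the inverse of its position block; this
    makes [K] feasible. Normality serves the converse: when these correlations vanish in [V],
    comparing the two blocks is enough to put a state below [V]. The state is never brought to
    xp-form. The rows of the local symplectic matrices are carried along as a frame, so no
    invariance under local symplectic maps has to be shown. Independence of the purification is a
    result: the inequalities close up for each one. *)

Section MatrixEntries.
Context {R : pzRingType} {m n : nat}.
Implicit Types A B : 'M[R]_(m, n).

Lemma addmxE A B i j : (A + B) i j = A i j + B i j.
Proof. by rewrite mxE. Qed.

Lemma oppmxE A i j : (- A) i j = - A i j.
Proof. by rewrite mxE. Qed.

Lemma scalemxE a A i j : (a *: A) i j = a * A i j.
Proof. by rewrite mxE. Qed.

Lemma mulrnmxE A k i j : (A *+ k) i j = A i j *+ k.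
Proof. by elim: k => [|k IH]; rewrite ?mulr0n ?mxE // !mulrS mxE IH. Qed.
End MatrixEntries.

Definition mxlinE := (@addmxE, @oppmxE, @scalemxE, @mulrnmxE).

(* Closes an identity between linear combinations of the same matrices. *)
Ltac mxlin := apply/matrixP=> ? ?; rewrite !mxlinE; ring.

Section Psd.
Context {R : rcfType}.
Implicit Types m n p q : nat.

Definition dot n (u v : 'cV[R]_n) : R := (u^T *m v) 0 0.

Lemma dotC n (u v : 'cV[R]_n) : dot u v = dot v u.
Proof. by rewrite /dot -[in LHS](trmxK v) -trmx_mul mxE. Qed.

Lemma dotDl n (u v w : 'cV[R]_n) : dot (u + v) w = dot u w + dot v w.
Proof. by rewrite /dot linearD mulmxDl mxE. Qed.

Lemma dotDr n (u v w : 'cV[R]_n) : dot w (u + v) = dot w u + dot w v.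
Proof. by rewrite /dot mulmxDr mxE. Qed.

Lemma dotNl n (u v : 'cV[R]_n) : dot (- u) v = - dot u v.
Proof. by rewrite /dot linearN mulNmx mxE. Qed.

Lemma dotNr n (u v : 'cV[R]_n) : dot u (- v) = - dot u v.
Proof. by rewrite /dot mulmxN mxE. Qed.

Lemma dotZl n a (u v : 'cV[R]_n) : dot (a *: u) v = a * dot u v.
Proof. by rewrite /dot linearZ /= -scalemxAl mxE. Qed.

Lemma dotZr n a (u v : 'cV[R]_n) : dot u (a *: v) = a * dot u v.
Proof. by rewrite /dot -scalemxAr mxE. Qed.

Definition dotE := (@dotDl, @dotDr, @dotNl, @dotNr, @dotZl, @dotZr).

Lemma dot_mull m n (A : 'M[R]_(m, n)) u v : dot (A *m u) v = dot u (A^T *m v).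
Proof. by rewrite /dot trmx_mul mulmxA. Qed.

Lemma dot_mulr m n (A : 'M[R]_(m, n)) u v : dot u (A *m v) = dot (A^T *m u) v.
Proof. by rewrite dot_mull trmxK. Qed.

Lemma dotE_sum n (u v : 'cV[R]_n) : dot u v = \sum_i u i 0 * v i 0.
Proof. by rewrite /dot mxE; apply: eq_bigr => i _; rewrite mxE. Qed.

Lemma dotvv_ge0 n (u : 'cV[R]_n) : 0 <= dot u u.
Proof. by rewrite dotE_sum; apply: sumr_ge0 => i _; rewrite -expr2 sqr_ge0. Qed.

Lemma dotvv_eq0 n (u : 'cV[R]_n) : dot u u = 0 -> u = 0.
Proof.
rewrite dotE_sum => /eqP; rewrite psumr_eq0 => [/allP h|i _]; last first.
  by rewrite -expr2 sqr_ge0.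
apply/matrixP => i j; rewrite (ord1 j) mxE.
by have := h i (mem_index_enum _); rewrite /= mulf_eq0 orbb => /eqP.
Qed.

Lemma dot0l n (u : 'cV[R]_n) : dot 0 u = 0.
Proof. by rewrite /dot trmx0 mul0mx mxE. Qed.

Lemma dot_col_mx m n (u1 v1 : 'cV[R]_m) (u2 v2 : 'cV[R]_n) :
  dot (col_mx u1 u2) (col_mx v1 v2) = dot u1 v1 + dot u2 v2.
Proof. by rewrite /dot tr_col_mx mul_row_col mxE. Qed.

Definition psd n (M : 'M[R]_n) : Prop :=
  M^T = M /\ forall x : 'cV[R]_n, 0 <= dot x (M *m x).

(** Invertibility replaces strict positivity because inverses are taken throughout; [pd_ker] and
    [psd_pd] recover the usual form. *)
Definition pd n (M : 'M[R]_n) : Prop := psd M /\ M \in unitmx.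

Lemma psdD n (M N : 'M[R]_n) : psd M -> psd N -> psd (M + N).
Proof.
move=> [sM hM] [sN hN]; split; first by rewrite linearD /= sM sN.
by move=> x; rewrite mulmxDl dotDr addr_ge0.
Qed.

Lemma psdZ n a (M : 'M[R]_n) : 0 <= a -> psd M -> psd (a *: M).
Proof.
move=> a0 [sM hM]; split; first by rewrite linearZ /= sM.
by move=> x; rewrite -scalemxAl dotZr mulr_ge0.
Qed.

Lemma psd_cong m n (T : 'M[R]_(m, n)) M : psd M -> psd (T *m M *m T^T).
Proof.
move=> [sM hM]; split; first by rewrite !trmx_mul trmxK sM mulmxA.
by move=> x; rewrite -!mulmxA dot_mulr.
Qed.

Lemma psd_congT m n (T : 'M[R]_(n, m)) M : psd M -> psd (T^T *m M *m T).
Proof. by move=> /(psd_cong T^T); rewrite trmxK. Qed.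

Lemma psd_gram m n (T : 'M[R]_(m, n)) : psd (T *m T^T).
Proof.
split; first by rewrite trmx_mul trmxK.
by move=> x; rewrite -mulmxA dot_mulr dotvv_ge0.
Qed.

Lemma psd1 n : psd (1%:M : 'M[R]_n).
Proof. by have := psd_gram (1%:M : 'M[R]_n); rewrite trmx1 mulmx1. Qed.

Lemma psd0 n : psd (0 : 'M[R]_n).
Proof. by have := psd_gram (0 : 'M[R]_n); rewrite trmx0 mulmx0. Qed.

Lemma psd_eq0 n (M N : 'M[R]_n) : M = N -> psd (M - N).
Proof. by move=> ->; rewrite subrr; apply: psd0. Qed.

Lemma psd_trans n (M N P : 'M[R]_n) : psd (N - M) -> psd (P - N) -> psd (P - M).
Proof. by move=> h1 h2; have := psdD h2 h1; rewrite addrA subrK. Qed.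

(** For small negative [t] the linear term wins; the test value [- a / (b + 1)] also covers
    [b = 0]. *)
Lemma quadratic_ge0_lin0 (a b : R) : 0 <= a -> 0 <= b ->
  (forall t, 0 <= 2 * t * a + t ^+ 2 * b) -> a = 0.
Proof.
move=> a0 b0 key; have := key (- a / (b + 1)).
have b1 : b + 1 != 0 by rewrite gt_eqF //; lra.
have -> : 2 * (- a / (b + 1)) * a + (- a / (b + 1)) ^+ 2 * b
        = - ((a / (b + 1)) ^+ 2 * (b + 2)) by field.
rewrite oppr_ge0 => h; have : (a / (b + 1)) ^+ 2 * (b + 2) = 0.
  by apply/eqP; rewrite eq_le h mulr_ge0 ?sqr_ge0 //; lra.
move/eqP; rewrite mulf_eq0 sqrf_eq0 mulf_eq0 invr_eq0 (negPf b1) orbF.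
by case/orP => /eqP // h'; lra.
Qed.

Lemma psd_ker n (M : 'M[R]_n) x : psd M -> dot x (M *m x) = 0 -> M *m x = 0.
Proof.
move=> [sM hM] hx; apply: dotvv_eq0; set y := M *m x.
pose b := dot y (M *m y); have b0 : 0 <= b by exact: hM.
apply: quadratic_ge0_lin0 b0 _ => [|t]; first exact: dotvv_ge0.
have := hM (x + t *: y); rewrite mulmxDr -scalemxAr !dotE hx.
rewrite (dot_mulr M x y) sM -/y -/b; lra.
Qed.

Lemma unitmx_ker n (M : 'M[R]_n) : (forall x : 'cV_n, M *m x = 0 -> x = 0) -> M \in unitmx.
Proof.
move=> h; rewrite -unitmx_tr -row_free_unit -kermx_eq0; apply/eqP/row_matrixP => i.
apply: trmx_inj; rewrite row0 trmx0; apply: h.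
by rewrite -{1}[M]trmxK -trmx_mul -row_mul mulmx_ker row0 trmx0.
Qed.

Lemma pd_ker n (M : 'M[R]_n) x : pd M -> dot x (M *m x) = 0 -> x = 0.
Proof.
by move=> [pM uM] /(psd_ker pM) h; rewrite -(mulKmx uM x) h mulmx0.
Qed.

Lemma psd_pd n (M : 'M[R]_n) :
  psd M -> (forall x, dot x (M *m x) = 0 -> x = 0) -> pd M.
Proof.
move=> pM h; split=> //; apply: unitmx_ker => x Mx; apply: h.
by rewrite Mx dotC dot0l.
Qed.

Lemma pd_sym n (M : 'M[R]_n) : pd M -> M^T = M.
Proof. by case=> [[]]. Qed.

Lemma pdD n (M N : 'M[R]_n) : pd M -> psd N -> pd (M + N).
Proof.
move=> hM hN; apply: psd_pd => [|x]; first by apply: psdD => //; case: hM.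
rewrite mulmxDl dotDr => /eqP; rewrite paddr_eq0 ?(proj2 hN) ?(proj2 (proj1 hM)) //.
by case/andP => /eqP /(pd_ker hM).
Qed.

Lemma pd_le n (M N : 'M[R]_n) : pd M -> psd (N - M) -> pd N.
Proof. by move=> hM /(pdD hM); rewrite addrC subrK. Qed.

Lemma pdZ n a (M : 'M[R]_n) : 0 < a -> pd M -> pd (a *: M).
Proof.
move=> a0 [pM uM]; split; first exact: psdZ (ltW a0) pM.
by rewrite unitmxZ // unitfE gt_eqF.
Qed.

Lemma pd_inv n (M : 'M[R]_n) : pd M -> pd (invmx M).
Proof.
move=> [[sM hM] uM]; split; last by rewrite unitmx_inv.
have sI : (invmx M)^T = invmx M by rewrite trmx_inv sM.
split=> // x; have := hM (invmx M *m x).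
by rewrite mulKVmx // dotC.
Qed.

Lemma pd_cong m n (T : 'M[R]_(m, n)) (U : 'M[R]_(n, m)) M :
  T *m U = 1%:M -> pd M -> pd (T *m M *m T^T).
Proof.
move=> TU hM; apply: psd_pd => [|x]; first by apply: psd_cong; case: hM.
rewrite -!mulmxA dot_mulr => /(pd_ker hM) h.
by rewrite -[x]mul1mx -trmx1 -TU trmx_mul -mulmxA h mulmx0.
Qed.

Lemma pd1 n : pd (1%:M : 'M[R]_n).
Proof. by split; [exact: psd1 | exact: unitmx1]. Qed.

Lemma pd_inv_anti n (A B : 'M[R]_n) :
  pd A -> psd (B - A) -> psd (invmx A - invmx B).
Proof.
move=> hA hAB; have hB := pd_le hA hAB.
have [uA uB] := (hA.2, hB.2); have iA := pd_inv hA; have iB := pd_inv hB.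
set a := invmx A in iA *; set b := invmx B in iB *; set D := B - A.
(* This is [a - b = a D b] with the outer [a] replaced by [b + b D a]. *)
have -> : a - b = b *m D *m b + (b *m D) *m a *m (b *m D)^T.
  have -> : (b *m D)^T = D *m b by rewrite trmx_mul (pd_sym iB) (proj1 hAB).
  have e1 : D *m b = 1%:M - A *m b by rewrite mulmxBl mulmxV.
  have e2 : b *m D = 1%:M - b *m A by rewrite mulmxBr mulVmx.
  rewrite -[b *m D *m b]mulmxA e1 e2 !mulmxBr !mulmxBl !mulmx1 !mul1mx.
  rewrite -[b *m A *m a]mulmxA mulmxV // !mulmx1 !mulmxA.
  rewrite mulVmx // mul1mx; mxlin.
apply: psdD; last exact: psd_cong iA.1.
by have := psd_cong b hAB; rewrite (pd_sym iB).
Qed.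

(** Both inequalities say that [block_mx (invmx S) T^T T S'] is positive semidefinite; the proof
    writes the difference as a sum of two congruences. *)
Lemma psd_inv_compress m n (T : 'M[R]_(m, n)) S S' :
  pd S -> pd S' -> psd (S' - T *m S *m T^T) ->
  psd (invmx S - T^T *m invmx S' *m T).
Proof.
move=> hS hS' h; set Z := T^T *m invmx S'; set Y := Z *m T.
have ZY : T^T *m Z^T = Y by rewrite trmx_mul trmxK (pd_sym (pd_inv hS')) mulmxA.
have YY : Y^T = Y by rewrite trmx_mul.
have ZSZ : Z *m S' *m Z^T = Y by rewrite /Z mulmxKV ?hS'.2.
have -> : invmx S - Y = (1%:M - Y *m S) *m invmx S *m (1%:M - Y *m S)^T
     + Z *m (S' - T *m S *m T^T) *m Z^T.
  rewrite (mulmxBr Z) (mulmxBl _ _ Z^T) ZSZ -!mulmxA ZY !mulmxA -/Y.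
  rewrite linearB /= trmx1 trmx_mul (pd_sym hS) YY mulmxBl mul1mx mulmxK ?hS.2 //.
  rewrite mulmxBr mulmx1 mulmxBl !mulmxA mulVmx ?hS.2 // mul1mx; mxlin.
by apply: psdD; apply: psd_cong => //; case: (pd_inv hS).
Qed.

(** Turns an inclusion of kernels into a factorisation, so that [Z] can stand for [B X^-1] when [X]
    is singular. *)
Lemma psd_range p n (B : 'M[R]_(p, n)) X : psd X ->
  (forall v, dot v (X *m v) = 0 -> B *m v = 0) -> exists Z, B = Z *m X.
Proof.
move=> pX h; apply/submxP; rewrite submxE; apply/eqP/matrixP => i j.
have : B *m col j (cokermx X) = 0.
  by apply: h; rewrite colE mulmxA mulmx_coker mul0mx dotC dot0l.
by rewrite colE mulmxA -colE => /matrixP /(_ i 0); rewrite !mxE.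
Qed.

Lemma psd_bound n (P : 'M[R]_n) : P^T = P -> exists2 c, 0 < c & psd (c *: 1%:M - P).
Proof.
(* The sum of the [|P i j|] bounds the form because [|x_i x_j| <= dot x x]; the extra 1 makes [c]
   positive. *)
move=> sP; pose c := 1 + \sum_i \sum_j `|P i j|.
have S0 : 0 <= \sum_i \sum_j `|P i j| by do 2!apply: sumr_ge0 => ? _.
exists c; first by rewrite /c; lra.
split; first by rewrite linearB linearZ /= trmx1 sP.
move=> x; rewrite mulmxBl -scalemxAl mul1mx !dotE subr_ge0.
have -> : dot x (P *m x) = \sum_i \sum_j x i 0 * (P i j * x j 0).
  rewrite dotE_sum; apply: eq_bigr => i _; rewrite mxE mulr_sumr.
  by apply: eq_bigr => j _.
have le_dot i : x i 0 ^+ 2 <= dot x x.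
  rewrite dotE_sum (bigD1 i) //= -expr2 lerDl.
  by apply: sumr_ge0 => k _; rewrite -expr2 sqr_ge0.
apply: (@le_trans _ _ ((\sum_i \sum_j `|P i j|) * dot x x)).
  rewrite mulr_suml; apply: ler_sum => i _; rewrite mulr_suml; apply: ler_sum => j _.
  have -> : x i 0 * (P i j * x j 0) = P i j * (x i 0 * x j 0) by ring.
  apply: (le_trans (ler_norm _)); rewrite normrM ler_wpM2l //.
  have := le_dot i; have := le_dot j => h1 h2.
  rewrite ler_norml; have := sqr_ge0 (x i 0 + x j 0); have := sqr_ge0 (x i 0 - x j 0).
  by rewrite sqrrB sqrrD => h3 h4; apply/andP; split; lra.
by rewrite ler_wpM2r ?dotvv_ge0 // /c; lra.
Qed.

Lemma psd_inv_bound n (M : 'M[R]_n) c : 0 < c -> pd M ->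
  psd (c *: 1%:M - invmx M) -> psd (c *: M - 1%:M).
Proof.
move=> c0 hM /(pd_inv_anti (pd_inv hM)); rewrite invmxK => /(psdZ (ltW c0)).
rewrite invmxZ; last by case: (pdZ c0 (pd1 n)).
by rewrite invmx1 scalerBr scalerA divff ?gt_eqF // scale1r.
Qed.

Lemma pd_bound n (M : 'M[R]_n) : pd M -> exists2 c, 0 < c & psd (c *: M - 1%:M).
Proof.
move=> hM; have [c c0 hc] := psd_bound (pd_sym (pd_inv hM)).
by exists c => //; apply: psd_inv_bound.
Qed.

End Psd.

(** * Schur complements and determinants *)

Section Schur.
Context {R : rcfType}.
Implicit Types m n p q : nat.

Lemma ulsubmxB m n p q (A B : 'M[R]_(m + n, p + q)) :
  ulsubmx (A - B) = ulsubmx A - ulsubmx B.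
Proof. by apply/matrixP => i j; rewrite !mxE. Qed.

Lemma drsubmxB m n p q (A B : 'M[R]_(m + n, p + q)) :
  drsubmx (A - B) = drsubmx A - drsubmx B.
Proof. by apply/matrixP => i j; rewrite !mxE. Qed.

Lemma ursubmxB m n p q (A B : 'M[R]_(m + n, p + q)) :
  ursubmx (A - B) = ursubmx A - ursubmx B.
Proof. by apply/matrixP => i j; rewrite !mxE. Qed.

Lemma ulsubmx_cong n1 n2 (M : 'M[R]_(n1 + n2)) :
  ulsubmx M = row_mx 1%:M 0 *m M *m (row_mx 1%:M 0)^T.
Proof.
rewrite -{2}[M]submxK mul_row_block !mul1mx !mul0mx !addr0 tr_row_mx trmx1 trmx0.
by rewrite mul_row_col mulmx1 mulmx0 addr0.
Qed.

Lemma drsubmx_cong n1 n2 (M : 'M[R]_(n1 + n2)) :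
  drsubmx M = row_mx 0 1%:M *m M *m (row_mx 0 1%:M)^T.
Proof.
rewrite -{2}[M]submxK mul_row_block !mul1mx !mul0mx !add0r tr_row_mx trmx1 trmx0.
by rewrite mul_row_col mulmx1 mulmx0 add0r.
Qed.

Lemma psd_ul n1 n2 (M : 'M[R]_(n1 + n2)) : psd M -> psd (ulsubmx M).
Proof. by rewrite ulsubmx_cong => /psd_cong. Qed.

Lemma psd_dr n1 n2 (M : 'M[R]_(n1 + n2)) : psd M -> psd (drsubmx M).
Proof. by rewrite drsubmx_cong => /psd_cong. Qed.

Lemma pd_ul n1 n2 (M : 'M[R]_(n1 + n2)) : pd M -> pd (ulsubmx M).
Proof.
rewrite ulsubmx_cong; apply: (pd_cong (U := col_mx 1%:M 0)).
by rewrite mul_row_col mulmx1 mul0mx addr0.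
Qed.

Lemma pd_dr n1 n2 (M : 'M[R]_(n1 + n2)) : pd M -> pd (drsubmx M).
Proof.
rewrite drsubmx_cong; apply: (pd_cong (U := col_mx 0 1%:M)).
by rewrite mul_row_col mulmx1 mul0mx add0r.
Qed.

Lemma sym_dr n1 n2 (M : 'M[R]_(n1 + n2)) : M^T = M -> (drsubmx M)^T = drsubmx M.
Proof. by move=> sM; rewrite trmx_drsub sM. Qed.

Lemma sym_ur n1 n2 (M : 'M[R]_(n1 + n2)) : M^T = M -> (ursubmx M)^T = dlsubmx M.
Proof. by move=> sM; rewrite trmx_ursub sM. Qed.

Lemma psd_bdiag n1 n2 (A : 'M[R]_n1) (B : 'M[R]_n2) :
  psd A -> psd B -> psd (block_mx A 0 0 B).
Proof.
move=> [sA hA] [sB hB]; split; first by rewrite tr_block_mx sA sB !trmx0.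
move=> x; rewrite -[x]vsubmxK mul_block_col !mul0mx addr0 add0r dot_col_mx.
by rewrite addr_ge0.
Qed.

Lemma pd_bdiag n1 n2 (A : 'M[R]_n1) (B : 'M[R]_n2) :
  pd A -> pd B -> pd (block_mx A 0 0 B).
Proof.
move=> [pA uA] [pB uB]; split; first exact: psd_bdiag.
by rewrite unitmxE det_ublock unitrM -!unitmxE uA.
Qed.

Definition schur n1 n2 (M : 'M[R]_(n1 + n2)) : 'M[R]_n1 :=
  ulsubmx M - ursubmx M *m invmx (drsubmx M) *m dlsubmx M.

Lemma det_schur n1 n2 (M : 'M[R]_(n1 + n2)) :
  drsubmx M \in unitmx -> \det M = \det (drsubmx M) * \det (schur M).
Proof.
move=> u; have e : M = block_mx 1%:M (ursubmx M *m invmx (drsubmx M)) 0 1%:M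
    *m block_mx (schur M) 0 (dlsubmx M) (drsubmx M).
  rewrite -[LHS]submxK mulmx_block !mul1mx !mul0mx !add0r.
  by rewrite subrK mulmxKV.
by rewrite [in LHS]e det_mulmx det_ublock det_lblock !det1 !mul1r mulrC.
Qed.

Lemma schur_block n1 n2 (A : 'M[R]_n1) B C (D : 'M[R]_n2) :
  schur (block_mx A B C D) = A - B *m invmx D *m C.
Proof. by rewrite /schur block_mxKul block_mxKur block_mxKdl block_mxKdr. Qed.

Lemma invmx_schur n1 n2 (M : 'M[R]_(n1 + n2)) :
  M \in unitmx -> drsubmx M \in unitmx -> invmx (schur M) = ulsubmx (invmx M).
Proof.
move=> uM uD; have := mulmxV uM; set N := invmx M.
rewrite -[M]submxK -[N]submxK mulmx_block (scalar_mx_block n1 n2 1).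
rewrite -/(schur M) !block_mxKul.
case/eq_block_mx => e1 _ e2 _.
have e3 : dlsubmx N = - (invmx (drsubmx M) *m (dlsubmx M *m ulsubmx N)).
  rewrite -[LHS](mulKmx uD) -mulmxN; congr (_ *m _); apply/eqP.
  by rewrite -subr_eq0 opprK addrC e2.
have e4 : schur M *m ulsubmx N = 1%:M.
  by rewrite -e1 e3 mulmxN /schur mulmxBl !mulmxA.
have [uS _] := mulmx1_unit e4.
by rewrite submxK -[RHS]mul1mx -(mulVmx uS) -mulmxA e4 mulmx1.
Qed.

(** Completing the square in the linear estimate [Y] of the first system by the second: the Schur
    complement is the least error covariance. The bound [schur_le] and monotonicity come from
    this. *)
Lemma schur_sqr n1 n2 (M : 'M[R]_(n1 + n2)) Y : M^T = M -> drsubmx M \in unitmx ->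
  row_mx 1%:M Y *m M *m (row_mx 1%:M Y)^T
  = schur M + (Y + ursubmx M *m invmx (drsubmx M)) *m drsubmx M
            *m (Y + ursubmx M *m invmx (drsubmx M))^T.
Proof.
move=> sM uD; rewrite -[in LHS](submxK M) mul_row_block !mul1mx tr_row_mx trmx1.
rewrite mul_row_col mulmx1 (mulmxDl Y) mulmxKV // linearD /= trmx_mul trmx_inv.
rewrite (sym_ur sM) (sym_dr sM) /schur !mulmxDl !mulmxDr !mulmxA mulmxK //.
by mxlin.
Qed.

Lemma schur_cong n1 n2 (M : 'M[R]_(n1 + n2)) : M^T = M -> drsubmx M \in unitmx ->
  exists Y, schur M = row_mx 1%:M Y *m M *m (row_mx 1%:M Y)^T.
Proof.
move=> sM uD; exists (- (ursubmx M *m invmx (drsubmx M))).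
by rewrite schur_sqr // addNr !mul0mx addr0.
Qed.

Lemma schur_le n1 n2 (M : 'M[R]_(n1 + n2)) Y : M^T = M -> pd (drsubmx M) ->
  psd (row_mx 1%:M Y *m M *m (row_mx 1%:M Y)^T - schur M).
Proof.
move=> sM hD; rewrite schur_sqr ?hD.2 // addrAC subrr add0r.
exact/psd_cong/hD.1.
Qed.

Lemma schur_le_ul n1 n2 (M : 'M[R]_(n1 + n2)) : M^T = M -> pd (drsubmx M) ->
  psd (ulsubmx M - schur M).
Proof. by move=> sM hD; rewrite ulsubmx_cong; apply: schur_le. Qed.

Lemma pd_schur n1 n2 (M : 'M[R]_(n1 + n2)) : pd M -> pd (schur M).
Proof.
move=> hM; have [Y ->] := schur_cong (pd_sym hM) (proj2 (pd_dr hM)).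
apply: (pd_cong (U := col_mx 1%:M 0)) => //.
by rewrite mul_row_col mulmx1 mulmx0 addr0.
Qed.

Lemma schur_mono n1 n2 (M N : 'M[R]_(n1 + n2)) :
  pd M -> psd (N - M) -> psd (schur N - schur M).
Proof.
move=> hM hMN; have hN := pd_le hM hMN.
have [Y ->] := schur_cong (pd_sym hN) (proj2 (pd_dr hN)).
apply: psd_trans (schur_le Y (pd_sym hM) (pd_dr hM)) _.
by rewrite -mulmxBl -mulmxBr; apply: psd_cong.
Qed.

Lemma pd_block n1 n2 (M : 'M[R]_(n1 + n2)) :
  M^T = M -> pd (drsubmx M) -> pd (schur M) -> pd M.
Proof.
move=> sM hD hS; set Y := ursubmx M *m invmx (drsubmx M).
have -> : M = block_mx 1%:M Y 0 1%:M *m block_mx (schur M) 0 0 (drsubmx M)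
    *m (block_mx 1%:M Y 0 1%:M)^T.
  rewrite tr_block_mx !trmx1 trmx0 !mulmx_block !mul1mx !mul0mx !mulmx1 !mulmx0.
  rewrite !addr0 !add0r /Y trmx_mul trmx_inv (sym_ur sM) (sym_dr sM).
  rewrite mulmxA !mulmxKV ?hD.2 // mulmxA mulmxV ?hD.2 // mul1mx.
  by rewrite subrK submxK.
apply: (pd_cong (U := block_mx 1%:M (- Y) 0 1%:M)); last exact: pd_bdiag.
rewrite mulmx_block !mul1mx !mul0mx !mulmx1 !mulmx0 !addr0 !add0r addrC subrr.
by rewrite -scalar_mx_block.
Qed.

Lemma pd_det_gt0 n (M : 'M[R]_n) : pd M -> 0 < \det M.
Proof.
elim: n M => [|n IH] M; first by rewrite det_mx00 ltr01.
rewrite -[n.+1]/(1 + n)%N in M * => hM; rewrite det_schur ?(proj2 (pd_dr hM)) //.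
apply: mulr_gt0; first exact/IH/pd_dr.
move: (schur M) (pd_schur hM) => S hS; rewrite det_mx11.
have e (x : 'cV[R]_1) : dot x (S *m x) = x 0 0 * (S 0 0 * x 0 0).
  by rewrite dotE_sum big_ord1 [(S *m x) _ _]mxE big_ord1.
rewrite lt_def; apply/andP; split; last first.
  by have := proj2 (proj1 hS) 1%:M; rewrite e !mxE mulr1 mul1r.
apply/negP => /eqP S0; have := pd_ker (x := 1%:M) hS; rewrite e S0 mul0r mulr0.
by move=> /(_ erefl) /matrixP /(_ 0 0); rewrite !mxE => /eqP; rewrite oner_eq0.
Qed.

Lemma psd11 (M : 'M[R]_1) : psd M -> 0 <= M 0 0.
Proof.
by move=> [_ /(_ 1%:M)]; rewrite mulmx1 /dot trmx1 mul1mx.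
Qed.

Lemma psd_dr0 n1 n2 (M : 'M[R]_(n1 + n2)) : psd M -> drsubmx M = 0 -> ursubmx M = 0.
Proof.
move=> pM D0; apply/matrixP => i j.
have := psd_ker (x := col_mx 0 (delta_mx j 0)) pM.
rewrite -[M in M *m _]submxK mul_block_col D0 !mulmx0 mul0mx !add0r.
rewrite dot_col_mx dot0l dotC dot0l addr0 => /(_ erefl) /eqP.
rewrite col_mx_eq0 => /andP[/eqP /matrixP /(_ i 0) + _].
by rewrite -colE !mxE.
Qed.

(** Monotonicity and its equality case share one induction: the determinant is a product of two
    monotone positive factors, a smaller block and a 1x1 Schur complement, so equal products force
    equal factors. *)
Lemma det_mono_eq n (A B : 'M[R]_n) :
  pd A -> psd (B - A) -> \det A <= \det B /\ (\det A = \det B -> A = B).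
Proof.
elim: n A B => [|n IH] A B; first by rewrite !det_mx00 !thinmx0.
rewrite -[n.+1]/(1 + n)%N in A B * => hA hAB; have hB := pd_le hA hAB.
have hdr : psd (drsubmx B - drsubmx A) by have := psd_dr hAB; rewrite drsubmxB.
have [dA dB] := (pd_dr hA, pd_dr hB).
have [le_d eq_d] := IH _ _ dA hdr.
rewrite !det_schur ?dA.2 ?dB.2 //.
have le_s : \det (schur A) <= \det (schur B).
  by have := psd11 (schur_mono hA hAB); rewrite !det_mx11 addmxE oppmxE subr_ge0.
have [gdA gdB] := (pd_det_gt0 dA, pd_det_gt0 dB).
have [gsA gsB] := (pd_det_gt0 (pd_schur hA), pd_det_gt0 (pd_schur hB)).
split; first by apply: ler_pM => //; exact: ltW.
move=> e.
have e1 : \det (drsubmx A) = \det (drsubmx B).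
  apply/eqP; rewrite eq_le le_d /= leNgt; apply/negP => h; move/eqP: e; apply/negP.
  by rewrite lt_eqF // (lt_le_trans (y := \det (drsubmx B) * \det (schur A))) //
    ?ltr_pM2r ?ler_pM2l.
have e2 : \det (schur A) = \det (schur B).
  by move: e; rewrite e1; apply: mulfI; rewrite gt_eqF.
have eD := eq_d e1.
have eU : ursubmx A = ursubmx B.
  have := psd_dr0 hAB; rewrite drsubmxB ursubmxB eD subrr => /(_ erefl) /eqP.
  by rewrite subr_eq0 => /eqP.
have eL : dlsubmx A = dlsubmx B.
  by rewrite -(sym_ur (pd_sym hA)) -(sym_ur (pd_sym hB)) eU.
have eS : schur A = schur B.
  by apply/matrixP => i j; rewrite !ord1; move: e2; rewrite !det_mx11.
move: eS; rewrite /schur eU eL eD => /addIr eUl.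
by rewrite -[A]submxK -[B]submxK eUl eU eL eD.
Qed.

Lemma det_mono n (A B : 'M[R]_n) : pd A -> psd (B - A) -> \det A <= \det B.
Proof. by move=> hA hAB; case: (det_mono_eq hA hAB). Qed.

Lemma det_mono_inj n (A B : 'M[R]_n) :
  pd A -> psd (B - A) -> \det A = \det B -> A = B.
Proof. by move=> hA hAB; case: (det_mono_eq hA hAB). Qed.

(** Cholesky's algorithm; when the first pivot vanishes, so do its row and column. *)
Lemma psd_factor n (M : 'M[R]_n) : psd M -> exists L : 'M[R]_n, M = L *m L^T.
Proof.
elim: n M => [|n IH] M; first by exists 0; rewrite !thinmx0.
rewrite -[n.+1]/(1 + n)%N in M * => hM; have sM := proj1 hM.
pose a := M 0 0.
have ulE : ulsubmx M = a%:M.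
  by apply/matrixP => i j; rewrite !ord1 !mxE mulr1n; congr (M _ _); apply/val_inj.
have a0 : 0 <= a.
  by have := psd11 (psd_ul hM); rewrite ulE mxE mulr1n.
have [az | an] := eqVneq a 0.
- have [L' hL'] := IH _ (psd_dr hM).
  have dl0 : dlsubmx M = 0.
    apply/matrixP => i j; have := psd_ker (x := col_mx (delta_mx j 0) 0) hM.
    rewrite -[M in M *m _]submxK mul_block_col ulE az.
    rewrite raddf0 mul0mx !mulmx0 !addr0.
    rewrite dot_col_mx dot0l dotC dot0l addr0 => /(_ erefl) /eqP.
    rewrite col_mx_eq0 => /andP[_ /eqP /matrixP /(_ i 0)].
    by rewrite -colE !mxE.
  have ur0 : ursubmx M = 0 by have := trmx_dlsub M; rewrite sM dl0 trmx0.
  exists (block_mx 0 0 0 L').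
  rewrite tr_block_mx mulmx_block !trmx0 !mul0mx !mulmx0 !add0r -hL'.
  by rewrite -[LHS]submxK dl0 ur0 ulE az raddf0.
pose s := Num.sqrt a; have ss : s * s = a by rewrite -expr2 sqr_sqrtr.
have s0 : s != 0 by apply: contra an => /eqP s0; rewrite -ss s0 mul0r.
pose c := s^-1 *: dlsubmx M.
have cc : c *m c^T = a^-1 *: (dlsubmx M *m ursubmx M).
  by rewrite /c linearZ /= -scalemxAl -scalemxAr scalerA -invfM ss trmx_dlsub sM.
have [L' hL'] : exists L' : 'M[R]_n, drsubmx M - c *m c^T = L' *m L'^T.
  apply: IH; have := psd_cong (row_mx (- a^-1 *: dlsubmx M) 1%:M) hM.
  rewrite -{2}[M]submxK mul_row_block !mul1mx ulE mul_mx_scalar scalerA mulrN divff //.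
  rewrite scaleN1r addNr tr_row_mx mul_row_col mul0mx add0r trmx1 mulmx1 -scalemxAl.
  by rewrite addrC scaleNr -cc.
exists (block_mx s%:M 0 c L').
rewrite tr_block_mx mulmx_block !trmx0 !mul0mx !mulmx0 !addr0 -hL' addrC subrK.
rewrite tr_scalar_mx -scalar_mxM ss mul_scalar_mx mul_mx_scalar /c linearZ /=.
by rewrite !scalerA divff // !scale1r trmx_dlsub sM -ulE submxK.
Qed.

End Schur.

(** * Determinant inequalities *)

(** Sylvester's identity: both sides are the determinant of [block_mx 1%:M X (- Y) 1%:M]. *)
Lemma det1_mulmxC (R : comPzRingType) m n (X : 'M[R]_(m, n)) (Y : 'M[R]_(n, m)) :
  \det (1%:M + X *m Y) = \det (1%:M + Y *m X).
Proof.
have e1 : block_mx (1%:M + X *m Y) X 0 1%:M *m block_mx 1%:M 0 (- Y) 1%:M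
    = block_mx 1%:M X (- Y) 1%:M.
  by rewrite mulmx_block !mulmx1 !mulmx0 !mul1mx mulmxN addrK !add0r.
have e2 : block_mx 1%:M 0 (- Y) 1%:M *m block_mx 1%:M X 0 (1%:M + Y *m X)
    = block_mx 1%:M X (- Y) 1%:M.
  rewrite mulmx_block !mulmx1 !mulmx0 !mul1mx mulNmx !addr0.
  by rewrite mul0mx addr0 addrCA addNr addr0.
move: (congr1 determinant e1) (congr1 determinant e2).
rewrite !det_mulmx !det_ublock !det_lblock !det1 !mul1r !mulr1 => ->.
by move=> ->.
Qed.

(** [m] and [n] may be different expressions for one dimension, so [\det O] cannot be formed;
    Sylvester's identity replaces multiplicativity. *)
Lemma det_isometry (R : comPzRingType) m n (O : 'M[R]_(m, n)) K :
  O *m O^T = 1%:M -> O^T *m O = 1%:M -> \det (O *m K *m O^T) = \det K.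
Proof.
move=> h1 h2; have -> : O *m K *m O^T = 1%:M + O *m ((K - 1%:M) *m O^T).
  by rewrite mulmxA mulmxBr mulmxBl mulmx1 h1 addrC subrK.
by rewrite det1_mulmxC -mulmxA h2 mulmx1 addrC subrK.
Qed.

Section DetInequalities.
Context {R : rcfType}.
Implicit Types m n p q : nat.

Lemma det_add_gram m n (S : 'M[R]_m) (L : 'M[R]_(m, n)) : S \in unitmx ->
  \det (S + L *m L^T) = \det S * \det (1%:M + L^T *m (invmx S *m L)).
Proof.
move=> uS; rewrite -det1_mulmxC -det_mulmx.
by rewrite mulmxDr mulmx1 mulmxA mulKVmx.
Qed.

(* Writing [D = L L^T], both ratios of determinants are of the form
   [det (1 + L^T Z L)], where [Z] is [T^T S'^-1 T] resp. [S^-1]. *)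
Lemma det_ratio m n (T : 'M[R]_(m, n)) S S' D :
  pd S -> pd S' -> psd (S' - T *m S *m T^T) -> psd D ->
  \det (S' + T *m D *m T^T) * \det S <= \det (S + D) * \det S'.
Proof.
move=> hS hS' hT /psd_factor[L ->].
have -> : T *m (L *m L^T) *m T^T = (T *m L) *m (T *m L)^T.
  by rewrite trmx_mul !mulmxA.
have [dS dS'] := (pd_det_gt0 hS, pd_det_gt0 hS').
rewrite !det_add_gram ?hS.2 ?hS'.2 //.
set u := \det (1%:M + (T *m L)^T *m _); set v := \det (1%:M + L^T *m _).
suff uv : u <= v.
  have : u * (\det S' * \det S) <= v * (\det S' * \det S).
    by apply: ler_wpM2r uv; rewrite mulr_ge0 // ltW.
  by congr (_ <= _); ring.
have h : psd (L^T *m (invmx S - T^T *m invmx S' *m T) *m L).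
  exact/psd_congT/psd_inv_compress.
apply: det_mono.
  apply: pdD; first exact: pd1.
  by rewrite mulmxA; apply: psd_congT; case: (pd_inv hS').
move: h; rewrite trmx_mul mulmxBr mulmxBl !mulmxA.
by rewrite opprD addrACA subrr add0r.
Qed.

(** The mutual information of a Gaussian with covariance [W] is half the logarithm of this ratio. *)
Definition mi_ratio n1 n2 (W : 'M[R]_(n1 + n2)) : R :=
  \det (ulsubmx W) * \det (drsubmx W) / \det W.

Lemma mi_ratio_schur n1 n2 (W : 'M[R]_(n1 + n2)) : pd W ->
  mi_ratio W = \det (ulsubmx W) / \det (schur W).
Proof.
move=> hW; have hD := pd_dr hW; rewrite /mi_ratio det_schur ?hD.2 //.
have [d1 d2] := (pd_det_gt0 hD, pd_det_gt0 (pd_schur hW)).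
by field; rewrite !gt_eqF.
Qed.

Lemma mi_ratio_ge1 n1 n2 (W : 'M[R]_(n1 + n2)) : pd W -> 1 <= mi_ratio W.
Proof.
move=> hW; rewrite mi_ratio_schur // ler_pdivlMr ?pd_det_gt0 ?mul1r //; last exact: pd_schur.
by apply: det_mono; [exact: pd_schur | exact: schur_le_ul (pd_sym hW) (pd_dr hW)].
Qed.

Lemma bdiag_cong m1 m2 n1 n2 p1 p2 q1 q2 (TA : 'M[R]_(m1, n1)) (TB : 'M[R]_(m2, n2))
    (NA : 'M[R]_(p1, q1)) (NB : 'M[R]_(p2, q2)) W :
  block_mx TA 0 0 TB *m W *m (block_mx NA 0 0 NB)^T
  = block_mx (TA *m ulsubmx W *m NA^T) (TA *m ursubmx W *m NB^T)
             (TB *m dlsubmx W *m NA^T) (TB *m drsubmx W *m NB^T).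
Proof.
rewrite -[in LHS](submxK W) tr_block_mx !trmx0 !mulmx_block.
by rewrite !mul0mx !mulmx0 !addr0 !add0r.
Qed.

Lemma bdiag_mulmx1 m1 m2 n1 n2 (TA : 'M[R]_(m1, n1)) (TB : 'M[R]_(m2, n2)) UA UB :
  TA *m UA = 1%:M -> TB *m UB = 1%:M ->
  block_mx TA 0 0 TB *m block_mx UA 0 0 UB = 1%:M.
Proof.
move=> hA hB; rewrite mulmx_block !mulmx0 !mul0mx !addr0 !add0r hA hB.
by rewrite -scalar_mx_block.
Qed.

(** Data processing under local linear maps. Compressing B can only raise the Schur complement, by
    [psd_inv_compress]; compressing A is [det_ratio] with [D] the part of A explained by B. *)
Lemma mi_ratio_proc m1 m2 n1 n2 (TA : 'M[R]_(m1, n1)) (TB : 'M[R]_(m2, n2)) UA UB W :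
  TA *m UA = 1%:M -> TB *m UB = 1%:M -> pd W ->
  mi_ratio (block_mx TA 0 0 TB *m W *m (block_mx TA 0 0 TB)^T) <= mi_ratio W.
Proof.
move=> hA hB hW; set T := block_mx TA 0 0 TB.
have hW' : pd (T *m W *m T^T) by apply: pd_cong hW; apply: bdiag_mulmx1 hA hB.
have hS := pd_schur hW; have hS' := pd_schur hW'.
rewrite !mi_ratio_schur //; move: hS'; rewrite /T bdiag_cong block_mxKul => hS'.
set S' := schur _ in hS' *; set S := schur W in hS *.
have hTS : pd (TA *m S *m TA^T) by apply: pd_cong hS; exact: hA.
have h1 : psd (S' - TA *m S *m TA^T).
  rewrite /S' /S schur_block /schur !mulmxBr !mulmxBl opprB addrC addrA subrK.
  have hB' : pd (TB *m drsubmx W *m TB^T) by apply: pd_cong (pd_dr hW); exact: hB.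
  have := psd_cong (TA *m ursubmx W) (psd_inv_compress (pd_dr hW) hB' (psd_eq0 erefl)).
  by rewrite trmx_mul (sym_ur (pd_sym hW)) !mulmxBr !mulmxBl !mulmxA.
rewrite ler_pdivrMr ?pd_det_gt0 // mulrAC ler_pdivlMr ?pd_det_gt0 //.
have hD : psd (ulsubmx W - S) := schur_le_ul (pd_sym hW) (pd_dr hW).
have := det_ratio (T := TA) hS hTS (psd_eq0 erefl) hD.
rewrite [S + _]addrC subrK -mulmxDl -mulmxDr [S + _]addrC subrK => /le_trans; apply.
by rewrite ler_pM2l ?(pd_det_gt0 (pd_ul hW)) // det_mono.
Qed.

(** Quantitative continuity: the upper bound serves the numerator and the lower one the denominator,
    at one power per dimension. *)
Lemma mi_ratio_sandwich n1 n2 (W W' : 'M[R]_(n1 + n2)) (s u : R) : 0 < s -> 0 < u ->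
  pd W -> pd W' -> psd (W' - s *: W) -> psd (u *: W - W') ->
  mi_ratio W' <= (u / s) ^+ (n1 + n2) * mi_ratio W.
Proof.
move=> s0 u0 hW hW' hs hu.
have e1 : \det (ulsubmx W') <= u ^+ n1 * \det (ulsubmx W).
  rewrite -detZ; apply: det_mono; first exact: pd_ul.
  have := psd_ul hu; congr psd; apply/matrixP => i j; by rewrite !mxE.
have e2 : \det (drsubmx W') <= u ^+ n2 * \det (drsubmx W).
  rewrite -detZ; apply: det_mono; first exact: pd_dr.
  have := psd_dr hu; congr psd; apply/matrixP => i j; by rewrite !mxE.
have e3 : s ^+ (n1 + n2) * \det W <= \det W'.
  by rewrite -detZ; apply: det_mono hs; exact: pdZ.
have [d1 d2] := (pd_det_gt0 hW, pd_det_gt0 hW').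
have [d3 d4] := (pd_det_gt0 (pd_ul hW'), pd_det_gt0 (pd_dr hW')).
have [d5 d6] := (pd_det_gt0 (pd_ul hW), pd_det_gt0 (pd_dr hW)).
rewrite /mi_ratio ler_pdivrMr // expr_div_n exprD.
apply: (@le_trans _ _ (u ^+ n1 * \det (ulsubmx W) * (u ^+ n2 * \det (drsubmx W)))).
  by apply: ler_pM => //; exact: ltW.
have sN : 0 < s ^+ (n1 + n2) by rewrite exprn_gt0.
set r := u ^+ n1 * _ * _.
have r0 : 0 <= r by rewrite /r !mulr_ge0 ?exprn_ge0 // ltW.
apply: (@le_trans _ _ (r * (\det W' / (s ^+ (n1 + n2) * \det W)))).
  by rewrite ler_peMr // ler_pdivlMr ?mul1r // mulr_gt0.
rewrite le_eqVlt; apply/orP; left; apply/eqP; rewrite /r.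
by field; rewrite !gt_eqF.
Qed.

End DetInequalities.

(** * Uncertainty relations and pure states *)

Section Uncertainty.
Context {R : rcfType}.
Implicit Types m n p q : nat.

(** These properties pass to block sums, so that A, E, AB and ABE are treated alike. *)
Definition symp_form n (Om : 'M[R]_n) : Prop :=
  Om^T = - Om /\ Om *m Om = - 1%:M.

(** The value of the Hermitian form of [V - i Om] at [x + i y], in real terms. *)
Definition uncert n (Om V : 'M[R]_n) : Prop := V^T = V /\
  forall x y : 'cV[R]_n, 0 <= dot x (V *m x) + dot y (V *m y) + 2 * dot x (Om *m y).

(** The uncertainty relation amounts to [sdual Om V <= V], and purity to equality. *)
Definition sdual n (Om V : 'M[R]_n) : 'M[R]_n := Om *m invmx V *m Om^T.

Lemma symp_form_unit n (Om : 'M[R]_n) : symp_form Om -> Om \in unitmx.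
Proof.
move=> [_ h]; have : Om *m (- Om) = 1%:M by rewrite mulmxN h opprK.
by case/mulmx1_unit.
Qed.

Lemma symp_form_mulT n (Om : 'M[R]_n) : symp_form Om ->
  Om *m Om^T = 1%:M /\ Om^T *m Om = 1%:M.
Proof. by move=> [-> h]; rewrite mulmxN mulNmx h opprK. Qed.

Lemma symp_form_bdiag n1 n2 (O1 : 'M[R]_n1) (O2 : 'M[R]_n2) :
  symp_form O1 -> symp_form O2 -> symp_form (block_mx O1 0 0 O2).
Proof.
move=> [t1 h1] [t2 h2]; split.
  by rewrite tr_block_mx t1 t2 !trmx0 opp_block_mx !oppr0.
rewrite mulmx_block !mul0mx !mulmx0 !addr0 !add0r h1 h2 scalar_mx_block.
by rewrite opp_block_mx !oppr0.
Qed.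

Lemma uncert_psd n (Om V : 'M[R]_n) : uncert Om V -> psd V.
Proof.
move=> [sV hV]; split=> // x; have := hV x 0.
by rewrite !mulmx0 !(dotC _ 0) !dot0l mulr0 !addr0.
Qed.

Lemma uncert_mono n (Om V W : 'M[R]_n) : uncert Om V -> psd (W - V) -> uncert Om W.
Proof.
move=> [sV hV] hW; split=> [|x y].
  have := proj1 hW; rewrite linearB /= sV => /addIr; exact.
have := hV x y; have := proj2 hW x; have := proj2 hW y.
rewrite !mulmxBl !dotE => h1 h2 h3; lra.
Qed.

(** A noiseless direction [x] would violate the uncertainty relation with its conjugate direction
    [Om^T *m x]. *)
Lemma uncert_pd n (Om V : 'M[R]_n) : symp_form Om -> uncert Om V -> pd V.
Proof.
move=> hOm hV; apply: psd_pd => [|x hx]; first exact: uncert_psd hV.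
have [OO _] := symp_form_mulT hOm.
apply: dotvv_eq0; pose y := Om^T *m x.
have b0 := proj2 (uncert_psd hV) y; set b := dot y _ in b0.
apply: quadratic_ge0_lin0 b0 _ => [|t]; first exact: dotvv_ge0.
have := hV.2 x (t *: y); rewrite -!scalemxAr !dotE hx -/b [Om *m y]mulmxA OO mul1mx.
lra.
Qed.

Lemma pd_sdual n (Om V : 'M[R]_n) : symp_form Om -> pd V -> pd (sdual Om V).
Proof.
move=> hOm hV; apply: (pd_cong (U := Om^T)); last exact: pd_inv.
by case: (symp_form_mulT hOm).
Qed.

Lemma sdual_anti n (Om A B : 'M[R]_n) :
  pd A -> psd (B - A) -> psd (sdual Om A - sdual Om B).
Proof. by move=> hA h; rewrite -mulmxBl -mulmxBr; apply/psd_cong/pd_inv_anti. Qed.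

Lemma sdualK n (Om V : 'M[R]_n) : symp_form Om -> V \in unitmx ->
  sdual Om (sdual Om V) = V.
Proof.
move=> hOm uV; have uO := symp_form_unit hOm; have [OO OO'] := symp_form_mulT hOm.
have : invmx (sdual Om V) = Om *m V *m Om^T.
  have uD : sdual Om V \in unitmx by rewrite !unitmx_mul unitmx_tr unitmx_inv uO uV.
  rewrite -[RHS](mulKmx uD); suff -> : sdual Om V *m (Om *m V *m Om^T) = 1%:M.
    by rewrite mulmx1.
  by rewrite /sdual !mulmxA -[_ *m Om^T *m Om]mulmxA OO' mulmx1 mulmxKV.
move=> e; rewrite {1}/sdual e !mulmxA hOm.2 mulNmx mul1mx -mulmxA -trmx_mul hOm.2.
by rewrite linearN /= trmx1 mulmxN mulmx1 opprK.
Qed.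

Lemma det_symp n (Om V : 'M[R]_n) : symp_form Om -> \det (Om *m V *m Om^T) = \det V.
Proof. by move=> /symp_form_mulT[h1 h2]; apply: det_isometry. Qed.

Lemma det_sdual n (Om V : 'M[R]_n) : symp_form Om -> \det (sdual Om V) = (\det V)^-1.
Proof. by move=> h; rewrite det_symp // det_inv. Qed.

(** The form in [uncert] is least at [y = - V^-1 Om^T x], where it is the form of [V - sdual Om V]
    at [x]. The converse [dual_uncert] completes the square at the same point. *)
Lemma uncert_dual n (Om V : 'M[R]_n) :
  symp_form Om -> uncert Om V -> psd (V - sdual Om V).
Proof.
move=> hOm hV; have pV := uncert_pd hOm hV; have sV := hV.1.
split; first by rewrite linearB /= (pd_sym (pd_sdual hOm pV)) sV.
move=> x; set w := invmx V *m (Om^T *m x).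
have := hV.2 x (- w); rewrite mulmxBl !mulmxN !dotE.
have -> : V *m w = Om^T *m x by rewrite /w mulKVmx ?pV.2.
have -> : sdual Om V *m x = Om *m w by rewrite /sdual -!mulmxA.
rewrite (dotC w) dot_mull trmxK; lra.
Qed.

Lemma dual_uncert n (Om V : 'M[R]_n) :
  pd V -> psd (V - sdual Om V) -> uncert Om V.
Proof.
move=> hV h; split; first exact: pd_sym.
move=> x y; set w := invmx V *m (Om^T *m x).
have := h.2 x; have := hV.1.2 (y + w); rewrite mulmxDr mulmxBl !dotE.
have -> : V *m w = Om^T *m x by rewrite /w mulKVmx ?hV.2.
have -> : sdual Om V *m x = Om *m w by rewrite /sdual -!mulmxA.
have -> : dot w (V *m y) = dot x (Om *m y).
  by rewrite dot_mulr (pd_sym hV) /w mulKVmx ?hV.2 // dot_mull trmxK.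
rewrite (dotC y (Om^T *m x)) (dotC w (Om^T *m x)) !dot_mull trmxK; lra.
Qed.

Lemma pure_sdual n (Om V : 'M[R]_n) : symp_form Om -> V \in unitmx ->
  V *m Om *m V = Om <-> sdual Om V = V.
Proof.
move=> hOm uV; have [OO OO'] := symp_form_mulT hOm; split=> h.
  have e : Om *m invmx V = V *m Om by rewrite -{1}h mulmxK.
  by rewrite /sdual e -mulmxA OO mulmx1.
by rewrite -{1}h /sdual -[_ *m Om^T *m Om]mulmxA OO' mulmx1 mulmxKV.
Qed.

(** [V] dominates its dual, whose determinant is inverse to that of [V]; when both are 1, the
    equality case of monotonicity applies. *)
Lemma uncert_pure n (Om V : 'M[R]_n) : symp_form Om -> uncert Om V -> \det V = 1 ->
  V *m Om *m V = Om.
Proof.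
move=> hOm hV dV; have pV := uncert_pd hOm hV; apply/pure_sdual => //; first exact: pV.2.
apply: det_mono_inj; [exact: pd_sdual | exact: uncert_dual |].
by rewrite det_sdual // dV invr1.
Qed.

Lemma pure_uncert n (Om V : 'M[R]_n) : symp_form Om -> psd V -> V *m Om *m V = Om ->
  uncert Om V /\ \det V = 1.
Proof.
move=> hOm hV h; have uO := symp_form_unit hOm.
have uV : V \in unitmx by move: uO; rewrite -h !unitmx_mul => /andP[_ ->].
have pV : pd V by [].
have e := (pure_sdual hOm uV).1 h; split.
  by apply: dual_uncert => //; rewrite e; apply: psd_eq0.
have d0 := pd_det_gt0 pV; have := det_sdual V hOm; rewrite e => e1.
have : \det V ^+ 2 = 1 by rewrite expr2 {2}e1 divff // gt_eqF.
by move/eqP; rewrite sqrf_eq1 => /orP[/eqP //|/eqP e2]; move: d0; rewrite e2; lra.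
Qed.

(* The ratio [r G = det (A + G) / det (sdual A + G)] is nonincreasing in [G]
   and satisfies [r G * r (sdual G) = (det A)^2]. *)
Lemma det_dual_add n (Om A G : 'M[R]_n) : symp_form Om ->
  uncert Om A -> uncert Om G -> \det (A + G) <= \det A * \det (sdual Om A + G).
Proof.
move=> hOm hA hG; have [pA pG] := (uncert_pd hOm hA, uncert_pd hOm hG).
have [pA' pG'] := (pd_sdual hOm pA, pd_sdual hOm pG).
have key (P Q : 'M[R]_n) : pd P -> pd Q ->
    \det (sdual Om P + sdual Om Q) = \det (P + Q) / (\det P * \det Q).
  move=> hP hQ; rewrite /sdual -mulmxDl -mulmxDr det_symp //.
  have -> : invmx P + invmx Q = invmx P *m (P + Q) *m invmx Q.
    by rewrite mulmxDr mulmxDl mulVmx ?hP.2 // mul1mx mulmxK ?hQ.2 // addrC.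
  by rewrite !det_mulmx !det_inv; field; rewrite !gt_eqF ?pd_det_gt0.
have pP : pd (sdual Om A + sdual Om G) by apply: pdD => //; case: pG'.
have pP' : pd (A + sdual Om G) by apply: pdD => //; case: pG'.
(* Since [sdual Om G <= G], monotonicity gives [r G <= r (sdual G)], and the product formula turns
   this into [(r G)^2 <= (det A)^2]. *)
have := det_ratio (T := 1%:M) pP pP' _ (uncert_dual hOm hG).
rewrite trmx1 mul1mx !mulmx1 mul1mx opprD addrACA subrr addr0.
move=> /(_ (uncert_dual hOm hA)).
have -> : A + sdual Om G + (G - sdual Om G) = A + G by mxlin.
have -> : sdual Om A + sdual Om G + (G - sdual Om G) = sdual Om A + G by mxlin.
have := key _ _ pA' pG; rewrite sdualK ?pA.2 // det_sdual // => ->.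
rewrite key //.
have [dA dG] := (pd_det_gt0 pA, pd_det_gt0 pG).
have d1 : 0 < \det (A + G) by apply/pd_det_gt0/pdD/(proj1 pG).
have d2 : 0 < \det (sdual Om A + G) by apply/pd_det_gt0/pdD/(proj1 pG).
set a := \det A in dA *; set g := \det G in dG *; set x := \det (A + G) in d1 *.
set y := \det _ in d2 * => h.
have h2 : x ^+ 2 <= (a * y) ^+ 2.
  have : x * (x / (a * g)) * (a * g) <= y * (y / (a^-1 * g)) * (a * g).
    by rewrite ler_wpM2r // ltW // mulr_gt0.
  by congr (_ <= _); field; rewrite !gt_eqF.
by move: h2; rewrite ler_pXn2r // nnegrE ltW // mulr_gt0.
Qed.

Lemma pure_blocks n e (O1 : 'M[R]_n) (O2 : 'M[R]_e) (g : 'M[R]_(n + e)) :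
  g^T = g -> g *m block_mx O1 0 0 O2 *m g = block_mx O1 0 0 O2 ->
  ulsubmx g *m O1 *m ursubmx g = - (ursubmx g *m O2 *m drsubmx g).
Proof.
move=> sg; rewrite -[g]submxK !mulmx_block !mulmx0 !addr0 !add0r.
case/eq_block_mx => _ + _ _; rewrite block_mxKul block_mxKur block_mxKdr.
by move=> /eqP; rewrite addr_eq0 => /eqP.
Qed.

(** A pure [g] is its own dual, and the corner of [invmx g] is the inverse of the Schur complement;
    hence [ulsubmx g] is the dual of [schur g]. *)
Lemma pure_schur n e (O1 : 'M[R]_n) (O2 : 'M[R]_e) (g : 'M[R]_(n + e)) :
  symp_form O1 -> symp_form O2 -> pd g ->
  g *m block_mx O1 0 0 O2 *m g = block_mx O1 0 0 O2 ->
  schur g = sdual O1 (ulsubmx g).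
Proof.
move=> h1 h2 pg h; have hO := symp_form_bdiag h1 h2.
have pD := pd_dr pg; have pV := pd_ul pg.
have e1 := (pure_sdual hO pg.2).1 h.
have e2 : sdual O1 (schur g) = ulsubmx g.
  by rewrite -[in RHS]e1 /sdual bdiag_cong block_mxKul invmx_schur ?pg.2 ?pD.2.
by rewrite -e2 sdualK // (proj2 (pd_schur pg)).
Qed.

End Uncertainty.

(** * Steering by a measurement on the purifying system *)

Lemma uncert_cong (R : rcfType) m n (T : 'M[R]_(m, n)) Om V :
  uncert Om V -> uncert (T *m Om *m T^T) (T *m V *m T^T).
Proof.
move=> [sV hV]; split=> [|x y]; first by rewrite !trmx_mul trmxK sV mulmxA.
by have := hV (T^T *m x) (T^T *m y); rewrite !dot_mull trmxK !mulmxA.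
Qed.

Lemma uncert_dr (R : rcfType) n1 n2 (P1 : 'M[R]_n1) (P2 : 'M[R]_n2) W :
  uncert (block_mx P1 0 0 P2) W -> uncert P2 (drsubmx W).
Proof.
move/(uncert_cong (row_mx 0 1%:M)).
by rewrite -!drsubmx_cong block_mxKdr.
Qed.

Section Steering.
Context {R : rcfType}.
Context {n e : nat} {O1 : 'M[R]_n} {O2 : 'M[R]_e} {g : 'M[R]_(n + e)}.
Hypotheses (hO1 : symp_form O1) (hO2 : symp_form O2).
Let hO : symp_form (block_mx O1 0 0 O2). Proof. exact: symp_form_bdiag. Qed.
Hypotheses (pg : pd g) (gOg : g *m block_mx O1 0 0 O2 *m g = block_mx O1 0 0 O2).

Let V := ulsubmx g.
Let C := ursubmx g.
Let D := drsubmx g.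
Let K := C *m invmx D *m C^T.

Let pV : pd V. Proof. exact: pd_ul. Qed.
Let pD : pd D. Proof. exact: pd_dr. Qed.

Lemma gap_sdual : K = V - sdual O1 V.
Proof.
rewrite -(pure_schur hO1 hO2 pg gOg) /schur opprB addrC subrK.
by rewrite /K /C (sym_ur (pd_sym pg)).
Qed.

Lemma corr_antisym : invmx D *m C^T = O2 *m C^T *m invmx V *m O1.
Proof.
have e1 : V *m O1 *m C = - (C *m O2 *m D) := pure_blocks (pd_sym pg) gOg.
have e2 : C *m O2 = - (V *m O1 *m C *m invmx D) by rewrite e1 mulNmx opprK mulmxK ?pD.2.
have e3 : O1 *m invmx V *m C *m O2 = C *m invmx D.
  rewrite -!mulmxA e2 !mulmxN !mulmxA mulmxKV ?pV.2 // hO1.2 !mulNmx mul1mx.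
  exact: opprK.
apply: trmx_inj; rewrite !trmx_mul trmxK !trmx_inv (pd_sym pV) (pd_sym pD) -e3.
by rewrite hO1.1 hO2.1 !mulmxN !mulNmx opprK !mulmxA.
Qed.

Let om1 x y := dot x (O1 *m y).

Let om1N x y : om1 y x = - om1 x y.
Proof. by rewrite /om1 dotC dot_mull hO1.1 mulNmx dotNr. Qed.

Let gap_sym : K^T = K.
Proof. by rewrite /K !trmx_mul trmxK trmx_inv (pd_sym pD) mulmxA. Qed.

Lemma gap_psd : psd K.
Proof. exact/psd_cong/(proj1 (pd_inv pD)). Qed.

Lemma gap_corr v : dot v (K *m v) = 0 -> C^T *m v = 0.
Proof.
rewrite /K -!mulmxA dot_mulr => /(pd_ker (pd_inv pD)); exact.
Qed.

(* [Gamma] is the noise to be added on the second system so that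
   conditioning yields [G]. On the complement of [ker C] it is
   [C^T (V - G)^-1 C - D], and on [ker C] it is [D]. *)
Lemma steering G : uncert O1 G -> psd (V - G) -> psd (K - (V - G)) ->
  (forall v, dot v ((V - G) *m v) = 0 -> K *m v = 0) ->
  exists2 Gamma, uncert O2 Gamma & V - C *m invmx (D + Gamma) *m C^T = G.
Proof.
move=> hG pX leX kerX; set X := V - G in pX leX kerX *.
have [zX hzX] : exists Z, C^T = Z *m X.
  apply: psd_range => // v /kerX Kv; apply: gap_corr.
  by rewrite Kv dotC dot0l.
have [zK hzK] : exists Z, C^T = Z *m K by apply: psd_range gap_psd _ => v /gap_corr.
have [zr hzr] : exists Z, X = Z *m K.
  apply: psd_range gap_psd _ => v Kv; apply: psd_ker => //.
  have := proj2 leX v; rewrite mulmxBl !dotE Kv => h.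
  by apply/eqP; rewrite eq_le (proj2 pX) andbT; lra.
have CX : C = X *m zX^T by rewrite -[LHS]trmxK hzX trmx_mul (proj1 pX).
have CK : C = K *m zK^T by rewrite -[LHS]trmxK hzK trmx_mul gap_sym.
have XK : X = K *m zr^T by rewrite -[LHS](proj1 pX) {1}hzr trmx_mul gap_sym.
(* [zX] and [zK] stand for [C^T X^-1] and [C^T K^-1]. The form [zK *m C] agrees with [D] on the
   [D]-orthogonal complement of [ker C] and vanishes on [ker C]. *)
pose Gamma := zX *m C + D - 2 *: (zK *m C).
have sX : (zX *m C)^T = zX *m C.
  by rewrite trmx_mul hzX -mulmxA -CX.
have sK : (zK *m C)^T = zK *m C.
  by rewrite trmx_mul hzK -mulmxA -CK.
have hG2 : uncert O2 Gamma.
  split=> [|x y].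
    by rewrite /Gamma !linearD linearN /= linearZ /= sX sK (pd_sym pD).
  (* Three inequalities will be added: [hX] at [p] and [q], the uncertainty of [G] at [(p, - q)],
     and that of [D] at [(x - r, y - r')]. *)
  pose u := zK^T *m x; pose u' := zK^T *m y.
  pose a := invmx V *m (O1 *m u); pose a' := invmx V *m (O1 *m u').
  (* Once [G] is eliminated, the lower bound is [2 p.Ku + 2 q.Ku' - p.Vp - q.Vq + 2 p.(O1 q)]; it is
     stationary at these [p] and [q]. *)
  pose p := u + a'; pose q := u' - a.
  have Va z : dot z (V *m a) = om1 z u by rewrite /a mulKVmx ?pV.2.
  have Va' z : dot z (V *m a') = om1 z u' by rewrite /a' mulKVmx ?pV.2.
  have vC z w : dot z (V *m w) = dot w (V *m z).
    by rewrite dotC dot_mull (pd_sym pV).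
  have Ku : K *m u = V *m u + O1 *m a.
    by rewrite gap_sdual mulmxBl /sdual hO1.1 mulmxN mulNmx opprK -!mulmxA.
  have Ku' : K *m u' = V *m u' + O1 *m a'.
    by rewrite gap_sdual mulmxBl /sdual hO1.1 mulmxN mulNmx opprK -!mulmxA.
  have Cx : C *m x = K *m u by rewrite /u mulmxA -CK.
  have Cy : C *m y = K *m u' by rewrite /u' mulmxA -CK.
  (* [C r = K u = C x], so [x - r] is the component of [x] in [ker C]; likewise [y - r']. *)
  pose r := invmx D *m (C^T *m u); pose r' := invmx D *m (C^T *m u').
  have Cr : C *m r = K *m u by rewrite /r !mulmxA.
  have Cr' : C *m r' = K *m u' by rewrite /r' !mulmxA.
  have rE : r = O2 *m (C^T *m a) by rewrite /r [LHS]mulmxA corr_antisym -!mulmxA.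
  have rE' : r' = O2 *m (C^T *m a') by rewrite /r' [LHS]mulmxA corr_antisym -!mulmxA.
  have O2O2 (z : 'cV_e) : O2 *m (O2 *m z) = - z by rewrite mulmxA hO2.2 mulNmx mul1mx.
  have KV z w : dot z (K *m w) = dot w (K *m z).
    by rewrite dotC dot_mull gap_sym.
  have hX z w : 2 * dot z (C *m w) - dot z (X *m z) <= dot w (zX *m C *m w).
    pose s := zX^T *m w.
    have Xs : X *m s = C *m w by rewrite /s mulmxA -CX.
    have es : dot s (C *m w) = dot w (zX *m C *m w) by rewrite /s dot_mull trmxK mulmxA.
    have := proj2 pX (s - z); rewrite mulmxBr Xs !dotE es.
    rewrite (dot_mulr X s z) (proj1 pX) Xs (dotC (C *m w) z); lra.
  have hp := hX p x; have hq := hX q y.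
  have hpq := hG.2 p (- q); rewrite !mulmxN !dotE opprK in hpq.
  have XE z : dot z (X *m z) = dot z (V *m z) - dot z (G *m z).
    by rewrite /X mulmxBl !dotE.
  rewrite !XE Cx in hp; rewrite !XE Cy in hq.
  have hD := (uncert_dr (proj1 (pure_uncert hO (proj1 pg) gOg))).2 (x - r) (y - r').
  rewrite -/D in hD.
  have Dr : D *m r = C^T *m u by rewrite /r mulKVmx ?pD.2.
  have Dr' : D *m r' = C^T *m u' by rewrite /r' mulKVmx ?pD.2.
  have xDr : dot x (D *m r) = dot u (K *m u) by rewrite Dr dot_mulr trmxK Cx dotC.
  have yDr : dot y (D *m r') = dot u' (K *m u') by rewrite Dr' dot_mulr trmxK Cy dotC.
  have rDr : dot r (D *m r) = dot u (K *m u) by rewrite Dr dot_mulr trmxK Cr dotC.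
  have rDr' : dot r' (D *m r') = dot u' (K *m u') by rewrite Dr' dot_mulr trmxK Cr' dotC.
  have rDx : dot r (D *m x) = dot u (K *m u) by rewrite dotC dot_mull (pd_sym pD).
  have rDy : dot r' (D *m y) = dot u' (K *m u') by rewrite dotC dot_mull (pd_sym pD).
  have Kua : dot a' (K *m u) = om1 u u' - om1 a a'.
    by rewrite Ku dotDr vC Va' -/(om1 a' a) (om1N a a').
  have Kua' : dot a (K *m u') = - om1 u u' + om1 a a'.
    by rewrite Ku' dotDr vC Va (om1N u u').
  have xOr : dot x (O2 *m r') = - (om1 u u' - om1 a a').
    by rewrite rE' O2O2 dotNr dot_mulr trmxK Cx dotC Kua.
  have rOy : dot r (O2 *m y) = - om1 u u' + om1 a a'.
    rewrite rE dot_mull mulmxA (proj2 (symp_form_mulT hO2)) mul1mx.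
    by rewrite dot_mull trmxK Cy Kua'.
  have rOr : dot r (O2 *m r') = - (om1 u u' - om1 a a').
    by rewrite rE' O2O2 dotNr dot_mulr trmxK Cr dotC Kua.
  have GE z w : C *m z = K *m w -> dot z (zK *m C *m z) = dot w (K *m w) ->
      dot z (Gamma *m z) = dot z (zX *m C *m z) + dot z (D *m z) - 2 * dot w (K *m w).
    by move=> h1 h2; rewrite /Gamma mulmxBl mulmxDl -scalemxAl !dotE h2.
  have xzK : dot x (zK *m C *m x) = dot u (K *m u).
    by rewrite -mulmxA Cx dot_mulr.
  have yzK : dot y (zK *m C *m y) = dot u' (K *m u').
    by rewrite -mulmxA Cy dot_mulr.
  rewrite (GE _ _ Cx xzK) (GE _ _ Cy yzK).
  move: hD; rewrite !mulmxBr !dotE xDr yDr rDr rDr' rDx rDy xOr rOy rOr.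
  move: hp hq hpq; rewrite Ku Ku' /p /q !mulmxBr !mulmxDr !dotE -!/(om1 _ _).
  rewrite !(vC a) !(vC a') !Va !Va'.
  have o1 := om1N u u'; have o2 := om1N a a'; have o3 := om1N u a.
  have o4 := om1N u' a'.
  lra.
exists Gamma => //; have pDG : pd (D + Gamma).
  by apply: pdD pD _; exact: uncert_psd hG2.
have XK' : X = C *m (invmx D *m (C^T *m zr^T)) by rewrite XK /K -!mulmxA.
have hzK' : zK *m C *m invmx D *m C^T = C^T by rewrite [RHS]hzK /K !mulmxA.
have e1 : (D - zK *m C) *m invmx D *m C^T = 0.
  by rewrite !mulmxBl mulmxV ?pD.2 // mul1mx hzK' subrr.
have e2 : zX *m C *m invmx D *m C^T *m zr^T = C^T.
  by rewrite -!mulmxA -XK' -hzX.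
(* Exhibits [(D + Gamma)^-1 C^T] as [D^-1 C^T zr^T], which [C] maps to [X]. *)
have e3 : (D + Gamma) *m (invmx D *m (C^T *m zr^T)) = C^T.
  have -> : D + Gamma = zX *m C + 2 *: (D - zK *m C) by rewrite /Gamma; mxlin.
  by rewrite mulmxDl -scalemxAl !mulmxA e1 mul0mx scaler0 addr0 e2.
have -> : C *m invmx (D + Gamma) *m C^T = X.
  by rewrite -mulmxA -e3 mulKmx ?pDG.2.
by rewrite /X opprB addrC subrK.
Qed.

End Steering.

(** * Position-momentum frames *)

Section Frames.
Context {R : rcfType}.
Implicit Types m n k : nat.

Lemma uncertD n (O1 O2 V W : 'M[R]_n) :
  uncert O1 V -> uncert O2 W -> uncert (O1 + O2) (V + W).
Proof.
move=> [sV hV] [sW hW]; split=> [|x y]; first by rewrite linearD /= sV sW.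
have := hV x y; have := hW x y; rewrite !mulmxDl !dotE; lra.
Qed.

Lemma uncertN n (Om V : 'M[R]_n) : uncert Om V -> uncert (- Om) V.
Proof.
move=> [sV hV]; split=> // x y; have := hV x (- y).
by rewrite mulNmx !mulmxN !dotE opprK.
Qed.

(* The second system is measured in the noise [G]; the commutator that the
   optimal linear estimate [Y] adds on the first system is compensated by [G]. *)
Lemma uncert_schur n e (O1 : 'M[R]_n) (O2 G : 'M[R]_e) g :
  symp_form O2 -> uncert (block_mx O1 0 0 O2) g -> uncert O2 G ->
  uncert O1 (schur (g + block_mx 0 0 0 G)).
Proof.
move=> hO2 hg hG.
have pD : pd (drsubmx g + G).
  by apply: pdD (uncert_psd hG); apply: (uncert_pd hO2); exact: uncert_dr hg.
have e0 : drsubmx (g + block_mx 0 0 0 G) = drsubmx g + G.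
  by rewrite -[in LHS](submxK g) add_block_mx block_mxKdr.
have sM : (g + block_mx 0 0 0 G)^T = g + block_mx 0 0 0 G.
  by rewrite linearD /= tr_block_mx !trmx0 hg.1 hG.1.
have [Y ->] : exists Y, schur (g + block_mx 0 0 0 G)
    = row_mx 1%:M Y *m (g + block_mx 0 0 0 G) *m (row_mx 1%:M Y)^T.
  by apply: schur_cong => //; rewrite e0; case: pD.
rewrite mulmxDr mulmxDl.
have -> : O1 = row_mx 1%:M Y *m block_mx O1 0 0 O2 *m (row_mx 1%:M Y)^T
             - Y *m O2 *m Y^T.
  rewrite mul_row_block tr_row_mx mul_row_col trmx1 !mul1mx !mulmx0 addr0 add0r.
  by rewrite mulmx1 addrK.
have -> : row_mx 1%:M Y *m block_mx 0 0 0 G *m (row_mx 1%:M Y)^T = Y *m G *m Y^T.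
  by rewrite mul_row_block tr_row_mx mul_row_col !mulmx0 !addr0 mul0mx !add0r.
by apply: uncertD; [|apply: uncertN]; apply: uncert_cong.
Qed.

(** The position and momentum rows of a symplectic matrix; the last clause says that they are
    complete. Keeping them apart makes the frame of a composite system block diagonal, although its
    positions are not contiguous. *)
Definition frame k n (Om : 'M[R]_n) (T N : 'M[R]_(k, n)) : Prop :=
  [/\ T *m Om *m T^T = 0, N *m Om *m N^T = 0, T *m Om *m N^T = 1%:M
    & T^T *m N - N^T *m T = Om].

(* The matrix with [T]-block [K], [N]-block [L] and no correlations between
   the quadratures [T] and [N]. *)
Definition xpstate k n (Om : 'M[R]_n) (T N : 'M[R]_(k, n)) (K L : 'M[R]_k) : 'M[R]_n :=
  (Om *m N^T) *m K *m (Om *m N^T)^T + (Om^T *m T^T) *m L *m (Om^T *m T^T)^T.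

Section OneFrame.
Context {k n : nat} {Om : 'M[R]_n} {T N : 'M[R]_(k, n)}.
Hypotheses (hO : symp_form Om) (hF : frame Om T N).
Local Notation X := (Om *m N^T).
Local Notation P := (Om^T *m T^T).
Local Notation st := (xpstate Om T N).

Lemma frame_TX : T *m X = 1%:M.
Proof. by case: hF => _ _ h _; rewrite mulmxA. Qed.

Lemma frame_TP : T *m P = 0.
Proof. by case: hF => h _ _ _; rewrite mulmxA hO.1 mulmxN mulNmx h oppr0. Qed.

Lemma frame_NX : N *m X = 0.
Proof. by case: hF => _ h _ _; rewrite mulmxA. Qed.

Lemma frame_NP : N *m P = 1%:M.
Proof.
case: hF => _ _ h _; apply: trmx_inj; rewrite !trmx_mul !trmxK trmx1.
exact: h.
Qed.

Lemma frame_XP : X *m P^T - P *m X^T = Om.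
Proof.
case: hF => _ _ _ h.
have -> : X *m P^T = Om *m (N^T *m T) *m Om by rewrite trmx_mul !trmxK !mulmxA.
have -> : P *m X^T = Om *m (T^T *m N) *m Om.
  by rewrite trmx_mul trmxK hO.1 !mulNmx !mulmxN opprK !mulmxA.
by rewrite -mulmxBl -mulmxBr -opprB h mulmxN hO.2 opprK mul1mx.
Qed.

Lemma frame_id : X *m T + P *m N = 1%:M.
Proof.
case: hF => _ _ _ h.
by rewrite hO.1 !mulNmx -!mulmxA -mulmxBr -opprB h mulmxN hO.2 opprK.
Qed.

Lemma st_mono K L K' L' : psd (K' - K) -> psd (L' - L) -> psd (st K' L' - st K L).
Proof.
move=> hK hL; rewrite /xpstate opprD addrACA -!mulmxBl -!mulmxBr.
by apply: psdD; apply: psd_cong.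
Qed.

Lemma st_T K L : T *m st K L *m T^T = K.
Proof.
rewrite /xpstate mulmxDr mulmxDl !mulmxA -[T *m _ *m _]mulmxA -[T *m Om^T *m _]mulmxA.
rewrite frame_TX frame_TP !mul0mx addr0 mul1mx -mulmxA -trmx_mul frame_TX.
by rewrite trmx1 mulmx1.
Qed.

(** In frame coordinates the state is [diag(K, K^-1)], which is symplectic. *)
Lemma st_pure K : pd K ->
  psd (st K (invmx K)) /\ st K (invmx K) *m Om *m st K (invmx K) = Om.
Proof.
move=> hK; split.
  by apply: psdD; apply: psd_cong; [case: hK | case: (pd_inv hK)].
have XOX : X^T *m Om *m X = 0.
  by rewrite trmx_mul trmxK -!mulmxA [Om^T *m _]mulmxA (proj2 (symp_form_mulT hO)) mul1mx frame_NX.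
have XOP : X^T *m Om *m P = 1%:M.
  rewrite trmx_mul trmxK -!mulmxA [Om^T *m (Om *m _)]mulmxA.
  by rewrite (proj2 (symp_form_mulT hO)) mul1mx frame_NP.
have POX : P^T *m Om *m X = - 1%:M.
  have sw (a b : 'M[R]_(n, k)) : (a^T *m Om *m b)^T = - (b^T *m Om *m a).
    by rewrite !trmx_mul trmxK hO.1 mulNmx mulmxN mulmxA.
  by rewrite -[LHS]opprK -sw XOP trmx1.
have POP : P^T *m Om *m P = 0.
  rewrite trmx_mul !trmxK -!mulmxA [Om *m (Om *m _)]mulmxA hO.2 mulNmx mul1mx mulmxN.
  by rewrite frame_TP oppr0.
rewrite /xpstate; set x := X in XOX XOP POX *; set p := P in XOP POX POP *.
rewrite -[RHS]frame_XP -/x -/p.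
rewrite !mulmxDl !mulmxDr.
have e (a b c d : 'M[R]_(n, k)) (A B : 'M[R]_k) :
  a *m A *m b^T *m Om *m (c *m B *m d^T) = a *m A *m (b^T *m Om *m c) *m B *m d^T.
  by rewrite !mulmxA.
rewrite !e XOX XOP POX POP !mulmx0 !mul0mx mulmx1 add0r addr0 mulmxN mulmx1 !mulNmx.
by rewrite mulmxK ?hK.2 // mulmxKV ?hK.2.
Qed.

Lemma xpstate_of V : V^T = V -> T *m V *m N^T = 0 ->
  V = st (T *m V *m T^T) (N *m V *m N^T).
Proof.
move=> sV h; have h' : N *m V *m T^T = 0.
  by apply: trmx_inj; rewrite !trmx_mul trmxK sV mulmxA h trmx0.
have e (A B : 'M[R]_(n, k)) (C D : 'M[R]_(k, n)) :
    (A *m C) *m V *m (B *m D)^T = A *m (C *m V *m D^T) *m B^T.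
  by rewrite trmx_mul !mulmxA.
have eV : V = (X *m T + P *m N) *m V *m (X *m T + P *m N)^T.
  by rewrite frame_id trmx1 mul1mx mulmx1.
rewrite [LHS]eV [(_ + _)^T]linearD /= !mulmxDl !mulmxDr !e h h' !mulmx0 !mul0mx.
by rewrite addr0 add0r.
Qed.

Lemma frame_pd W : pd W -> pd (T *m W *m T^T).
Proof. exact: pd_cong frame_TX. Qed.

(** Heisenberg's relation for several modes, valid also when [W] correlates positions with
    momenta. *)
Lemma frame_uncert W : uncert Om W -> psd (N *m W *m N^T - invmx (T *m W *m T^T)).
Proof.
move=> hW; have pK := frame_pd (uncert_pd hO hW); set K := T *m W *m T^T in pK *.
have iK := pd_inv pK.
split; first by rewrite linearB /= !trmx_mul trmxK hW.1 (pd_sym iK) mulmxA.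
move=> b; set a := invmx K *m b.
have := hW.2 (T^T *m (- a)) (N^T *m b).
case: hF => _ _ h _; rewrite !dot_mull !trmxK !mulmxA h -/K mul1mx mulmxN !dotE opprK.
have -> : K *m a = b by rewrite /a mulKVmx ?pK.2.
rewrite mulmxBl !dotE -/a (dotC a).
lra.
Qed.

End OneFrame.

Lemma frame_bdiag k1 k2 n1 n2 (O1 : 'M[R]_n1) (O2 : 'M[R]_n2)
    (T1 N1 : 'M[R]_(k1, n1)) (T2 N2 : 'M[R]_(k2, n2)) :
  frame O1 T1 N1 -> frame O2 T2 N2 ->
  frame (block_mx O1 0 0 O2) (block_mx T1 0 0 T2) (block_mx N1 0 0 N2).
Proof.
move=> [a1 b1 c1 d1] [a2 b2 c2 d2].
split; rewrite !tr_block_mx !trmx0 !mulmx_block !(mul0mx, mulmx0, addr0, add0r).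
- by rewrite a1 a2 block_mx0.
- by rewrite b1 b2 block_mx0.
- by rewrite c1 c2 -scalar_mx_block.
- by rewrite opp_block_mx add_block_mx !oppr0 !addr0 d1 d2.
Qed.

Definition std_form k : 'M[R]_(k + k) := block_mx 0 1%:M (- 1%:M) 0.

Lemma symp_std k : symp_form (std_form k).
Proof.
split; first by rewrite tr_block_mx opp_block_mx !linearN /= !trmx0 !trmx1 oppr0 opprK.
rewrite mulmx_block !mul0mx !mulmx0 !mulmxN !mulNmx !mulmx1 !addr0 !add0r.
by rewrite scalar_mx_block opp_block_mx oppr0.
Qed.

Lemma frame_std k : frame (std_form k) (row_mx 1%:M 0) (row_mx 0 1%:M).
Proof.
split; rewrite ?mul_row_block !tr_row_mx ?mul_row_col ?mul_col_row !trmx1 !trmx0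
  !(mul1mx, mul0mx, mulmx0, mulmx1, addr0, add0r) //.
by rewrite opp_block_mx add_block_mx !oppr0 !addr0 !add0r.
Qed.

Lemma symp_tr n (Om S : 'M[R]_n) : symp_form Om -> S *m Om *m S^T = Om -> S^T *m Om *m S = Om.
Proof.
move=> hO h.
have e : S *m (Om *m S^T *m - Om) = 1%:M by rewrite !mulmxA h mulmxN hO.2 opprK.
have := mulmx1C e; rewrite mulmxN mulNmx => e2.
by rewrite -[RHS]mulmx1 -e2 mulmxN !mulmxA hO.2 !mulNmx mul1mx opprK.
Qed.

Lemma frame_symp k n (Om S : 'M[R]_n) (T N : 'M[R]_(k, n)) : symp_form Om ->
  S *m Om *m S^T = Om -> frame Om T N -> frame Om (T *m S) (N *m S).
Proof.
move=> hO hS [a b c d].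
have e (A B : 'M[R]_(k, n)) : (A *m S) *m Om *m (B *m S)^T = A *m Om *m B^T.
  by rewrite trmx_mul !mulmxA -[A *m S *m Om]mulmxA -[A *m (S *m Om) *m _]mulmxA hS.
split; rewrite ?e // !trmx_mul -!mulmxA [T^T *m _]mulmxA [N^T *m _]mulmxA.
by rewrite -mulmxBr -mulmxBl d mulmxA symp_tr.
Qed.

(** The change of coordinates [M] is symplectic and enters twice, so [(det M)^2 = 1] suffices. *)
Lemma det_xpstate k (T N : 'M[R]_(k, k + k)) K L : frame (std_form k) T N ->
  \det (xpstate (std_form k) T N K L) = \det K * \det L.
Proof.
move=> hF; set Om := std_form k; have hO : symp_form Om := symp_std k.
set M := row_mx (Om *m N^T) (Om^T *m T^T).
have eM B C : M *m block_mx B 0 0 C *m M^T = xpstate Om T N B C.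
  by rewrite mul_row_block !mulmx0 addr0 add0r tr_row_mx mul_row_col.
have e1 : M *m Om *m M^T = Om.
  rewrite -[RHS](frame_XP hO hF) mul_row_block !mulmx0 !mulmxN !mulmx1 addr0 add0r.
  by rewrite tr_row_mx mul_row_col mulNmx addrC.
have uO : \det Om != 0 by have := symp_form_unit hO; rewrite unitmxE unitfE.
have : \det M * \det M = 1.
  apply: (mulIf uO); rewrite mul1r -[RHS](congr1 determinant e1) !det_mulmx det_tr.
  by rewrite mulrAC.
rewrite -eM !det_mulmx det_tr det_ublock mulrAC => ->.
by rewrite mul1r.
Qed.

End Frames.

(** * Bipartite direct sums *)

Section BipartiteSum.
Context {R : rcfType}.

Definition between n (Q P K : 'M[R]_n) : Prop :=
  [/\ pd K, psd (Q - K) & psd (P - invmx K)].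

(** The order A1 A2 : B1 B2 keeps the parties' blocks principal; [sel] regroups the coordinates by
    copy. *)
Definition bsum a1 b1 a2 b2 (Q1 : 'M[R]_(a1 + b1)) (Q2 : 'M[R]_(a2 + b2)) :
    'M[R]_((a1 + a2) + (b1 + b2)) :=
  block_mx (block_mx (ulsubmx Q1) 0 0 (ulsubmx Q2)) (block_mx (ursubmx Q1) 0 0 (ursubmx Q2))
           (block_mx (dlsubmx Q1) 0 0 (dlsubmx Q2)) (block_mx (drsubmx Q1) 0 0 (drsubmx Q2)).

Context {a1 b1 a2 b2 : nat}.

Definition sel1 : 'M[R]_(a1 + b1, (a1 + a2) + (b1 + b2)) :=
  block_mx (row_mx 1%:M 0) 0 0 (row_mx 1%:M 0).

Definition sel2 : 'M[R]_(a2 + b2, (a1 + a2) + (b1 + b2)) :=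
  block_mx (row_mx 0 1%:M) 0 0 (row_mx 0 1%:M).

Definition mx01E := (@mul1mx, @mul0mx, @mulmx0, @mulmx1, @addr0, @add0r, @trmx0, @trmx1).

Lemma sel11 : sel1 *m sel1^T = 1%:M.
Proof.
by rewrite tr_block_mx mulmx_block !tr_row_mx !mul_row_col !mx01E -scalar_mx_block.
Qed.

Lemma sel22 : sel2 *m sel2^T = 1%:M.
Proof.
by rewrite tr_block_mx mulmx_block !tr_row_mx !mul_row_col !mx01E -scalar_mx_block.
Qed.

Lemma sel12 : sel1 *m sel2^T = 0.
Proof.
by rewrite tr_block_mx mulmx_block !tr_row_mx !mul_row_col !mx01E block_mx0.
Qed.

Lemma sel21 : sel2 *m sel1^T = 0.
Proof. by rewrite -[LHS]trmxK trmx_mul trmxK sel12 trmx0. Qed.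

Lemma bsumE (Q1 : 'M[R]_(a1 + b1)) (Q2 : 'M[R]_(a2 + b2)) :
  bsum Q1 Q2 = sel1^T *m Q1 *m sel1 + sel2^T *m Q2 *m sel2.
Proof.
rewrite -{2}[Q1]submxK -{2}[Q2]submxK !tr_block_mx !mulmx_block !tr_row_mx.
rewrite !mx01E !mul_col_mx !mx01E !mul_mx_row !mx01E.
by rewrite add_block_mx !add_col_mx !mx01E -!block_mxEv.
Qed.

Lemma sel_sum : sel1^T *m sel1 + sel2^T *m sel2 = 1%:M.
Proof.
rewrite !tr_block_mx !mulmx_block !tr_row_mx !mul_col_row !mx01E.
by rewrite !add_block_mx !mx01E -!scalar_mx_block.
Qed.

Definition sel := col_mx sel1 sel2.

Lemma sel_isom : sel *m sel^T = 1%:M.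
Proof.
by rewrite tr_col_mx mul_col_row sel11 sel12 sel21 sel22 -scalar_mx_block.
Qed.

Lemma sel_isomT : sel^T *m sel = 1%:M.
Proof. by rewrite tr_col_mx mul_row_col sel_sum. Qed.

Lemma sel_block K : sel *m K *m sel^T = block_mx (sel1 *m K *m sel1^T) (sel1 *m K *m sel2^T)
                                                  (sel2 *m K *m sel1^T) (sel2 *m K *m sel2^T).
Proof. by rewrite tr_col_mx mul_col_mx mul_col_row. Qed.

Lemma sel_bsum (Q1 : 'M[R]_(a1 + b1)) (Q2 : 'M[R]_(a2 + b2)) :
  sel *m bsum Q1 Q2 *m sel^T = block_mx Q1 0 0 Q2.
Proof.
rewrite sel_block bsumE !mulmxDr !mulmxDl !mulmxA sel11 sel12 sel21 sel22 !mx01E.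
by rewrite -!mulmxA sel11 sel12 sel21 sel22 !mx01E.
Qed.

Lemma bsum_sel (Q1 : 'M[R]_(a1 + b1)) (Q2 : 'M[R]_(a2 + b2)) :
  bsum Q1 Q2 = sel^T *m block_mx Q1 0 0 Q2 *m sel^T^T.
Proof.
rewrite -sel_bsum trmxK -!mulmxA sel_isomT mulmx1 mulmxA sel_isomT.
by rewrite mul1mx.
Qed.

Lemma invmx_isom m n (J : 'M[R]_(m, n)) K : J *m J^T = 1%:M -> J^T *m J = 1%:M ->
  K \in unitmx -> invmx (J *m K *m J^T) = J *m invmx K *m J^T.
Proof.
move=> h1 h2 uK.
have e : J *m K *m J^T *m (J *m invmx K *m J^T) = 1%:M.
  by rewrite -!mulmxA [J^T *m (J *m _)]mulmxA h2 mul1mx [K *m _]mulmxA mulmxV // mul1mx.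
have [u _] := mulmx1_unit e.
by rewrite -[LHS]mulmx1 -e mulKmx.
Qed.

Lemma bsum_between (Q1 P1 K1 : 'M[R]_(a1 + b1)) (Q2 P2 K2 : 'M[R]_(a2 + b2)) :
  between Q1 P1 K1 -> between Q2 P2 K2 ->
  between (bsum Q1 Q2) (bsum P1 P2) (bsum K1 K2) /\
  mi_ratio (bsum K1 K2) = mi_ratio K1 * mi_ratio K2.
Proof.
move=> [pK1 hQ1 hP1] [pK2 hQ2 hP2].
have bB (A1 B1 : 'M[R]_(a1 + b1)) (A2 B2 : 'M[R]_(a2 + b2)) :
    psd (A1 - B1) -> psd (A2 - B2) -> psd (bsum A1 A2 - bsum B1 B2).
  move=> h1 h2; rewrite !bsumE opprD addrACA -!mulmxBl -!mulmxBr.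
  by apply: psdD; apply: psd_congT.
have e := bsum_sel K1 K2.
have pB := pd_bdiag pK1 pK2.
have pK : pd (bsum K1 K2).
  by rewrite e; apply: (pd_cong (U := sel)) pB; exact: sel_isomT.
have eI : invmx (bsum K1 K2) = bsum (invmx K1) (invmx K2).
  rewrite e invmx_isom ?trmxK ?sel_isom ?sel_isomT ?pB.2 //.
  by rewrite invmx_block_diag ?pB.2 // bsum_sel trmxK.
split; first by split=> //; [apply: bB | rewrite eI; apply: bB].
rewrite /mi_ratio -(det_isometry (bsum K1 K2) sel_isom sel_isomT) sel_bsum.
rewrite /bsum block_mxKul block_mxKdr !det_ublock invfM.
ring.
Qed.

(** [K1] is the first copy conditioned on the second, [K2] the second copy alone. The inverse of
    [K1] is a corner of that of [K], and the inverse of [K2] lies below the other corner, so both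
    are feasible. *)
Lemma between_bsum (Q1 P1 : 'M[R]_(a1 + b1)) (Q2 P2 : 'M[R]_(a2 + b2)) K :
  between (bsum Q1 Q2) (bsum P1 P2) K ->
  exists K1 K2, [/\ between Q1 P1 K1, between Q2 P2 K2 &
    mi_ratio K1 * mi_ratio K2 <= mi_ratio K].
Proof.
move=> [pK hQ hP]; pose M := sel *m K *m sel^T.
have pM : pd M by apply: pd_cong pK; exact: sel_isom.
have iM : invmx M = sel *m invmx K *m sel^T.
  by rewrite invmx_isom ?sel_isom ?sel_isomT ?pK.2.
have MQ : psd (block_mx Q1 0 0 Q2 - M).
  by rewrite -sel_bsum -mulmxBl -mulmxBr; apply: psd_cong.
have MP : psd (block_mx P1 0 0 P2 - invmx M).
  by rewrite iM -sel_bsum -mulmxBl -mulmxBr; apply: psd_cong.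
pose K1 := schur M; pose K2 := drsubmx M.
have pK1 : pd K1 := pd_schur pM; have pK2 : pd K2 := pd_dr pM.
have leM := schur_le_ul (pd_sym pM) pK2.
have iK1 : invmx K1 = ulsubmx (invmx M) by rewrite invmx_schur ?pM.2 ?pK2.2.
have iK2 : psd (drsubmx (invmx M) - invmx K2).
  pose T : 'M[R]_(a2 + b2, (a1 + b1) + (a2 + b2)) := row_mx 0 1%:M.
  have TT : T *m T^T = 1%:M by rewrite tr_row_mx mul_row_col !mx01E.
  have K2T : K2 = T *m M *m T^T by rewrite -drsubmx_cong.
  have := psd_cong T (psd_inv_compress pM pK2 (psd_eq0 K2T)).
  by rewrite mulmxBr mulmxBl -drsubmx_cong !mulmxA TT mul1mx -mulmxA TT mulmx1.
exists K1, K2; split.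
- split=> //; first apply: psd_trans leM _.
    by have := psd_ul MQ; rewrite ulsubmxB block_mxKul.
  by rewrite iK1; have := psd_ul MP; rewrite ulsubmxB block_mxKul.
- split=> //; first by have := psd_dr MQ; rewrite drsubmxB block_mxKdr.
  by apply: psd_trans iK2 _; have := psd_dr MP; rewrite drsubmxB block_mxKdr.
have dK : \det K = \det K2 * \det K1.
  by rewrite -[LHS](det_isometry K sel_isom sel_isomT) -/M (det_schur (proj2 pK2)).
have pA := pd_ul pK; have pB := pd_dr pK.
have K2E : K2 = sel2 *m K *m sel2^T by rewrite /K2 /M sel_block block_mxKdr.
have K2A : ulsubmx K2 = drsubmx (ulsubmx K).
  by rewrite K2E bdiag_cong block_mxKul -drsubmx_cong.
have K2B : drsubmx K2 = drsubmx (drsubmx K).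
  by rewrite K2E bdiag_cong block_mxKdr -drsubmx_cong.
have [YA hA] := schur_cong (pd_sym pA) (proj2 (pd_dr pA)).
have [YB hB] := schur_cong (pd_sym pB) (proj2 (pd_dr pB)).
(* Each party estimates its part of the first copy from its own part of the second. The joint
   estimate does at least as well, so the blocks of [K1] lie below the locally conditioned ones. *)
pose Y := block_mx YA 0 0 YB.
have := schur_le Y (pd_sym pM) pK2.
have -> : row_mx 1%:M Y *m M *m (row_mx 1%:M Y)^T
    = block_mx (row_mx 1%:M YA) 0 0 (row_mx 1%:M YB) *m K *m
      (block_mx (row_mx 1%:M YA) 0 0 (row_mx 1%:M YB))^T.
  have -> : block_mx (row_mx 1%:M YA) 0 0 (row_mx 1%:M YB) = row_mx 1%:M Y *m sel.
    rewrite mul_row_col mul1mx mulmx_block !mx01E add_block_mx !mx01E.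
    by rewrite !mul_mx_row !mx01E !add_row_mx !mx01E.
  by rewrite trmx_mul !mulmxA.
rewrite bdiag_cong -hA -hB => leY.
have leA : \det (ulsubmx K1) <= \det (schur (ulsubmx K)).
  apply: det_mono; first exact: pd_ul.
  by have := psd_ul leY; rewrite ulsubmxB block_mxKul.
have leB : \det (drsubmx K1) <= \det (schur (drsubmx K)).
  apply: det_mono; first exact: pd_dr.
  by have := psd_dr leY; rewrite drsubmxB block_mxKdr.
have [dK1 dK2] := (pd_det_gt0 pK1, pd_det_gt0 pK2).
rewrite /mi_ratio dK (det_schur (proj2 (pd_dr pA))) (det_schur (proj2 (pd_dr pB))).
rewrite -K2A -K2B mulf_div [\det K2 * _]mulrC ler_pM2r ?invr_gt0 ?mulr_gt0 //.
have [u1 u2] := (pd_det_gt0 (pd_ul pK1), pd_det_gt0 (pd_dr pK1)).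
have [u3 u4] := (pd_det_gt0 (pd_ul pK2), pd_det_gt0 (pd_dr pK2)).
have : \det (ulsubmx K1) * \det (drsubmx K1) * (\det (ulsubmx K2) * \det (drsubmx K2)) <=
   \det (schur (ulsubmx K)) * \det (schur (drsubmx K)) * (\det (ulsubmx K2) * \det (drsubmx K2)).
  rewrite ler_pM2r ?mulr_gt0 //; apply: ler_pM => //; exact: ltW.
by congr (_ <= _); ring.
Qed.

End BipartiteSum.

(** * Optimal measurements *)

Section OptimalMeasurements.
Context {R : rcfType}.

Lemma uncertZ n a (Om V : 'M[R]_n) : 0 <= a -> uncert Om V -> uncert (a *: Om) (a *: V).
Proof.
move=> a0 [sV hV]; split=> [|x y]; first by rewrite linearZ /= sV.
have := mulr_ge0 a0 (hV x y); rewrite -!scalemxAl !dotZr; lra.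
Qed.

Lemma uncert_ul n1 n2 (P1 : 'M[R]_n1) (P2 : 'M[R]_n2) W :
  uncert (block_mx P1 0 0 P2) W -> uncert P1 (ulsubmx W).
Proof.
move/(uncert_cong (row_mx 1%:M 0)).
by rewrite -!ulsubmx_cong block_mxKul.
Qed.

Lemma psd_le_scale n (V G : 'M[R]_n) : pd G -> V^T = V ->
  exists2 c, 0 < c & psd (c *: G - V).
Proof.
move=> /pd_bound[c c0 hc] /psd_bound[d d0 hd]; exists (d * c); first exact: mulr_gt0.
by apply: psd_trans hd _; rewrite -scalerA -scalerBr; apply: psdZ hc; exact: ltW.
Qed.

Lemma steering_near n e (O1 : 'M[R]_n) (O2 : 'M[R]_e) g G (eta : R) :
  symp_form O1 -> symp_form O2 -> pd g ->
  g *m block_mx O1 0 0 O2 *m g = block_mx O1 0 0 O2 ->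
  pd G -> G *m O1 *m G = O1 -> psd (ulsubmx g - G) -> 0 < eta ->
  exists Gamma, [/\ uncert O2 Gamma,
    psd ((1 + eta) *: G - schur (g + block_mx 0 0 0 Gamma)) &
    psd (schur (g + block_mx 0 0 0 Gamma) - (1 + eta)^-1 *: G)].
Proof.
move=> hO1 hO2 pg gOg pG GOG hVG eta0.
have hO := symp_form_bdiag hO1 hO2.
have ug := (pure_uncert hO (proj1 pg) gOg).1.
have uG := (pure_uncert hO1 (proj1 pG) GOG).1.
set V := ulsubmx g in hVG *; set C := ursubmx g; set D := drsubmx g.
have pD : pd D := pd_dr pg; have uD : uncert O2 D := uncert_dr ug.
pose K := C *m invmx D *m C^T.
have KE : K = V - sdual O1 V := gap_sdual hO1 hO2 pg gOg.
have pK : psd K := gap_psd pg.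
have schurE Gamma : schur (g + block_mx 0 0 0 Gamma) = V - C *m invmx (D + Gamma) *m C^T.
  rewrite -{1}[g]submxK add_block_mx !addr0 schur_block.
  by rewrite -(sym_ur (pd_sym pg)).
(* The state left when the second system is measured with noise [D]. Mixing a little of it into [G]
   makes [V - G'] dominate a multiple of [K], hence the kernel condition of [steering], which [G]
   alone may fail. *)
pose M := V - 2^-1 *: K.
have uM : uncert O1 M.
  have := uncert_schur hO2 ug uD; rewrite schurE.
  have -> : D + D = 2 *: D by mxlin.
  rewrite invmxZ; last by case: (pdZ (ltr0Sn R 1) pD).
  by rewrite -scalemxAr -scalemxAl.
have pM := uncert_pd hO1 uM.
have [c c0 hc] : exists2 c, 0 < c & psd (c *: G - M) by apply: psd_le_scale => //; exact: pd_sym.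
pose t := eta / ((1 + eta) * (1 + c)).
have e1 : 0 < 1 + eta by lra.
have c1 : 0 < 1 + c by lra.
have t0 : 0 < t by rewrite divr_gt0 // mulr_gt0.
have tc : t * c <= eta.
  rewrite /t mulrAC ler_pdivrMr ?mulr_gt0 // ler_pM2l //.
  have := mulr_gt0 eta0 c0; lra.
have te : (1 + eta)^-1 <= 1 - t.
  rewrite -subr_ge0 (_ : 1 - t - _ = eta * c / ((1 + eta) * (1 + c))).
    by rewrite ltW // divr_gt0 // mulr_gt0.
  by rewrite /t; field; rewrite !gt_eqF.
have t1 : 0 < 1 - t by apply: lt_le_trans te; rewrite invr_gt0.
have t2 : 0 < t / 2 by lra.
pose G' := (1 - t) *: G + t *: M.
have uG' : uncert O1 G'.
  have -> : O1 = (1 - t) *: O1 + t *: O1 by rewrite -scalerDl subrK scale1r.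
  by apply: uncertD; apply: uncertZ => //; exact: ltW.
have XE : V - G' = (1 - t) *: (V - G) + (t / 2) *: K.
  by rewrite /G' /M; mxlin.
have pX : psd (V - G').
  by rewrite XE; apply: psdD; apply: psdZ => //; exact: ltW.
(* Purity makes [G] its own dual, and duality reverses [G <= V]. *)
have hKG : psd (K - (V - G)).
  have -> : K - (V - G) = sdual O1 G - sdual O1 V.
    rewrite ((pure_sdual hO1 pG.2).1 GOG) KE; mxlin.
  exact: sdual_anti.
have leK : psd (K - (V - G')).
  have -> : K - (V - G') = (1 - t) *: (K - (V - G)) + (t / 2) *: K.
    by rewrite XE; apply/matrixP => i j; rewrite !mxlinE; field.
  by apply: psdD; apply: psdZ => //; exact: ltW.
have kerX v : dot v ((V - G') *m v) = 0 -> K *m v = 0.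
  rewrite XE mulmxDl -!scalemxAl !dotE => /eqP; rewrite paddr_eq0.
  - case/andP=> _; rewrite mulf_eq0 (gt_eqF t2) /= => /eqP; exact: psd_ker.
  - by rewrite mulr_ge0 ?(ltW t1) ?(proj2 hVG).
  - by rewrite mulr_ge0 ?(proj2 pK) // ltW.
have [Gamma uGam hGam] := steering hO1 hO2 pg gOg uG' pX leK kerX.
exists Gamma; rewrite schurE hGam; split=> //.
  have -> : (1 + eta) *: G - G' = t *: (c *: G - M) + (eta - t * c + t) *: G.
    by rewrite /G'; mxlin.
  apply: psdD; apply: psdZ => //; first exact: ltW.
    by rewrite addr_ge0 ?subr_ge0 // ltW.
  by case: pG.
have -> : G' - (1 + eta)^-1 *: G = (1 - t - (1 + eta)^-1) *: G + t *: M.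
  by rewrite /G'; mxlin.
apply: psdD; apply: psdZ; rewrite ?subr_ge0 //; [by case: pG | exact: ltW | by case: pM].
Qed.

(** Noise on B only raises the Schur complement, which for noiseless B is the dual of [ulsubmx g];
    [det_dual_add] then compares the determinants on A. *)
Lemma pure_mi_ratio n1 n2 (O1 G1 : 'M[R]_n1) (O2 G2 : 'M[R]_n2) g :
  symp_form O1 -> symp_form O2 -> pd g ->
  g *m block_mx O1 0 0 O2 *m g = block_mx O1 0 0 O2 ->
  uncert O1 G1 -> uncert O2 G2 ->
  mi_ratio (g + block_mx G1 0 0 G2) <= \det (ulsubmx g).
Proof.
move=> hO1 hO2 pg gOg u1 u2; have hO := symp_form_bdiag hO1 hO2.
have ug := (pure_uncert hO (proj1 pg) gOg).1.
have p1 := uncert_psd u1; have p2 := uncert_psd u2.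
have pW : pd (g + block_mx G1 0 0 G2) by apply: pdD => //; apply: psd_bdiag.
rewrite mi_ratio_schur // ler_pdivrMr ?pd_det_gt0 //; last exact: pd_schur.
rewrite -{1}[g]submxK add_block_mx block_mxKul.
apply: le_trans (det_dual_add hO1 (uncert_ul ug) u1) _.
rewrite ler_pM2l ?(pd_det_gt0 (pd_ul pg)) //.
apply: det_mono; first by apply: pdD => //; apply/pd_sdual/pd_ul.
rewrite -(pure_schur hO1 hO2 pg gOg).
have -> : schur g + G1 = schur (g + block_mx G1 0 0 0).
  rewrite -{2}[g]submxK add_block_mx schur_block !addr0 /schur; mxlin.
apply: schur_mono.
  by apply: pdD => //; apply: psd_bdiag => //; exact: psd0.
have -> : g + block_mx G1 0 0 G2 - (g + block_mx G1 0 0 0) = block_mx 0 0 0 G2.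
  by rewrite opprD addrACA subrr add0r opp_block_mx add_block_mx !subr0 subrr.
exact: psd_bdiag (psd0 _) p2.
Qed.

Lemma xpstate_ul n1 n2 k1 k2 (O1 : 'M[R]_n1) (O2 : 'M[R]_n2)
    (T1 N1 : 'M[R]_(k1, n1)) (T2 N2 : 'M[R]_(k2, n2)) K L :
  ulsubmx (xpstate (block_mx O1 0 0 O2) (block_mx T1 0 0 T2) (block_mx N1 0 0 N2) K L)
  = xpstate O1 T1 N1 (ulsubmx K) (ulsubmx L).
Proof.
rewrite /xpstate !tr_block_mx !mulmx_block !mx01E !tr_block_mx !mx01E.
have e (A : 'M[R]_(n1, k1)) (B : 'M[R]_(n2, k2)) M :
  block_mx A 0 0 B *m M *m block_mx A^T 0 0 B^T =
  block_mx (A *m ulsubmx M *m A^T) (A *m ursubmx M *m B^T)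
           (B *m dlsubmx M *m A^T) (B *m drsubmx M *m B^T).
  by rewrite -bdiag_cong tr_block_mx !trmx0.
by rewrite !e add_block_mx block_mxKul.
Qed.

(** The A-block has position part [K_A] and momentum part [(K^-1)_A], the inverse of the Schur
    complement of [K]. *)
Lemma det_xpstate_ul a b (TA NA : 'M[R]_(a, a + a)) (TB NB : 'M[R]_(b, b + b)) K :
  frame (std_form a) TA NA -> pd K ->
  \det (ulsubmx (xpstate (block_mx (std_form a) 0 0 (std_form b)) (block_mx TA 0 0 TB)
                   (block_mx NA 0 0 NB) K (invmx K))) = mi_ratio K.
Proof.
move=> hF pK; rewrite xpstate_ul det_xpstate // -invmx_schur ?pK.2 ?(proj2 (pd_dr pK)) // det_inv.
by rewrite mi_ratio_schur.
Qed.

Lemma homodyne_mi_ratio n1 n2 k1 k2 (O1 : 'M[R]_n1) (O2 : 'M[R]_n2)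
    (T1 N1 : 'M[R]_(k1, n1)) (T2 N2 : 'M[R]_(k2, n2)) V (eta : R) :
  let O := block_mx O1 0 0 O2 in
  let T := block_mx T1 0 0 T2 in let N := block_mx N1 0 0 N2 in
  symp_form O1 -> symp_form O2 -> frame O1 T1 N1 -> frame O2 T2 N2 ->
  uncert O V -> 0 < eta ->
  exists G1 G2, [/\ uncert O1 G1, uncert O2 G2 &
    forall W, uncert O W -> psd (V - W) ->
      between (T *m V *m T^T) (N *m V *m N^T) (T *m W *m T^T) /\
      mi_ratio (T *m W *m T^T) <=
        ((1 + eta) ^+ 2) ^+ (k1 + k2) * mi_ratio (W + block_mx G1 0 0 G2)].
Proof.
move=> O T N hO1 hO2 hF1 hF2 hV eta0.
have hO : symp_form O by exact: symp_form_bdiag.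
have hF : frame O T N by exact: frame_bdiag.
have [c c0 hc] : exists2 c, 0 < c & psd (c *: 1%:M - N *m V *m N^T).
  by apply: psd_bound; rewrite !trmx_mul trmxK hV.1 mulmxA.
(* [K >= 1 / c] for every [W], as [K^-1] is below the momentum block of [V]; position noise [t] is
   thus at most [eta * K]. The uniformity matters because [G1] and [G2] are fixed before the
   measurement on E. *)
pose t := eta / c; have t0 : 0 < t by rewrite divr_gt0.
have pt k : pd (t *: 1%:M : 'M[R]_k) by apply: pdZ (pd1 k).
pose G1 := xpstate O1 T1 N1 (t *: 1%:M) (invmx (t *: 1%:M)).
pose G2 := xpstate O2 T2 N2 (t *: 1%:M) (invmx (t *: 1%:M)).
have u1 : uncert O1 G1.
  by have [h1 h2] := st_pure hO1 hF1 (pt k1); case: (pure_uncert hO1 h1 h2).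
have u2 : uncert O2 G2.
  by have [h1 h2] := st_pure hO2 hF2 (pt k2); case: (pure_uncert hO2 h1 h2).
exists G1, G2; split=> // W uW hVW.
have pW := uncert_pd hO uW.
set K := T *m W *m T^T.
have pK : pd K := frame_pd hF pW.
have hL : psd (N *m W *m N^T - invmx K) := frame_uncert hO hF uW.
have hP : psd (N *m V *m N^T - invmx K).
  apply: psd_trans hL _; rewrite -mulmxBl -mulmxBr; exact: psd_cong.
have hQ : psd (T *m V *m T^T - K) by rewrite -mulmxBl -mulmxBr; exact: psd_cong.
split=> //.
have hcK : psd (c *: K - 1%:M).
  by apply: psd_inv_bound => //; apply: psd_trans hP hc.
pose Kt := K + t *: 1%:M.
have pKt : pd Kt by apply: pdD => //; case: (pt (k1 + k2)%N).
have h1 : mi_ratio K <= (1 / (1 + eta)^-1) ^+ (k1 + k2) * mi_ratio Kt.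
  have e1 : 0 < 1 + eta by lra.
  apply: mi_ratio_sandwich => //; first by rewrite invr_gt0.
    have -> : K - (1 + eta)^-1 *: Kt = ((1 + eta)^-1 * t) *: (c *: K - 1%:M).
      rewrite /Kt /t; apply/matrixP => i j; rewrite !mxlinE; field.
      by rewrite !gt_eqF.
    by apply: psdZ => //; rewrite mulr_ge0 ?invr_ge0 // ltW.
  by rewrite scale1r /Kt addrAC subrr add0r; case: (pt (k1 + k2)%N).
have h2 : mi_ratio Kt <= mi_ratio (W + block_mx G1 0 0 G2).
  have -> : Kt = T *m (W + block_mx G1 0 0 G2) *m T^T.
    rewrite mulmxDr mulmxDl -/K /Kt bdiag_cong block_mxKul block_mxKur block_mxKdl block_mxKdr.
    by rewrite !st_T // !mulmx0 !mul0mx scalar_mx_block scale_block_mx !scaler0.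
  apply: mi_ratio_proc (frame_TX hF1) (frame_TX hF2) _.
  by apply: pdD => //; apply: psd_bdiag; apply: uncert_psd; [exact: u1 | exact: u2].
(* One factor [1 + eta] would do; the square lets both directions share [half_log2_le]. *)
apply: le_trans h1 _; rewrite div1r invrK.
have m1 := mi_ratio_ge1 pKt.
apply: ler_pM => //; rewrite ?exprn_ge0 ?lerXn2r //; try lra.
- by rewrite nnegrE; lra.
- by rewrite nnegrE exprn_ge0 //; lra.
by rewrite expr2; have := mulr_gt0 eta0 eta0; lra.
Qed.

(* [Q - P^-1 = L L^T] is the Schur complement condition making the
   [n]-block of the inverse of [[Q, L], [L^T, 1]] equal to [P]. *)
Lemma purification_frame n k e (O1 : 'M[R]_n) (O2 : 'M[R]_e) (T N : 'M[R]_(k, n))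
    (T2 N2 : 'M[R]_(k, e)) V :
  symp_form O1 -> symp_form O2 -> frame O1 T N -> frame O2 T2 N2 ->
  uncert O1 V -> T *m V *m N^T = 0 ->
  exists g, [/\ psd g, g *m block_mx O1 0 0 O2 *m g = block_mx O1 0 0 O2 & ulsubmx g = V].
Proof.
move=> hO1 hO2 hF hF2 uV hTN; have hO := symp_form_bdiag hO1 hO2.
have pV := uncert_pd hO1 uV.
set Q := T *m V *m T^T; set P := N *m V *m N^T.
have pQ : pd Q := frame_pd hF pV.
have hP : psd (P - invmx Q) := frame_uncert hO1 hF uV.
have pP : pd P := pd_le (pd_inv pQ) hP.
have := pd_inv_anti (pd_inv pQ) hP; rewrite invmxK => /psd_factor[L hL].
pose B : 'M[R]_(k + k) := block_mx Q L L^T 1%:M.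
have sB : schur B = invmx P.
  by rewrite schur_block invmx1 mulmx1 -hL opprB addrC subrK.
have pB : pd B.
  apply: pd_block; rewrite ?sB ?block_mxKdr; [|exact: pd1|exact: pd_inv].
  by rewrite tr_block_mx trmxK trmx1 (pd_sym pQ).
have hFF := frame_bdiag hF hF2.
have [pg gOg] := st_pure hO hFF pB.
exists (xpstate (block_mx O1 0 0 O2) (block_mx T 0 0 T2) (block_mx N 0 0 N2) B (invmx B)).
split=> //; rewrite [RHS](xpstate_of hO1 hF uV.1 hTN) -/Q -/P.
have eP : ulsubmx (invmx B) = P.
  by rewrite -invmx_schur ?pB.2 ?block_mxKdr ?unitmx1 // sB invmxK.
by rewrite xpstate_ul eP block_mxKul.
Qed.

End OptimalMeasurements.

(** * Quantum covariance matrices over the reals *)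

Definition bilin (C : pzRingType) n (u : 'cV[C]_n) (M : 'M[C]_n) (v : 'cV[C]_n) : C :=
  (u^T *m M *m v) 0 0.

(** A generic scalar [c] replaces [i], so that [ring] can check the expansion. *)
Lemma bilin_expand (C : comPzRingType) n (A B : 'M[C]_n) (x y w v : 'cV[C]_n) (c : C) :
  w = x - c *: y -> v = x + c *: y ->
  bilin w (A - c *: B) v
  = bilin x A x + c * bilin x A y - c * bilin x B x - c * (c * bilin x B y)
    - c * bilin y A x - c * (c * bilin y A y) + c * (c * bilin y B x)
    + c * (c * (c * bilin y B y)).
Proof.
move=> -> ->; rewrite /bilin [(_ - _)^T]linearB /= [(_ *: _)^T]linearZ /=.
rewrite !(mulmxDl, mulmxDr, mulNmx, mulmxN) -!scalemxAl -!scalemxAr -!scalemxAl.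
by rewrite !mxlinE; ring.
Qed.

Section ComplexForms.
Context {R : realType}.

Lemma conjcE (z : R[i]) : Num.conj z = (z^*)%C.
Proof. by []. Qed.

Lemma hermitian_form n (A B : 'M[R]_n) (x y : 'cV[R]_n) :
  let z := \matrix_(i, j) (x i j +i* y i j)%C : 'cV[R[i]]_n in
  ((map_mx Num.conj z)^T *m (mxC A - 'i%C *: mxC B) *m z) 0 0
  = ((dot x (A *m x) + dot y (A *m y) + dot x (B *m y) - dot y (B *m x))
     +i* (dot x (A *m y) - dot y (A *m x) - dot x (B *m x) - dot y (B *m y)))%C.
Proof.
move=> z.
pose f (u : 'cV[R]_n) := map_mx (real_complex R) u.
have ez : z = f x + 'i%C *: f y.
  apply/matrixP => i j; rewrite !mxE; apply/eqP; rewrite eq_complex /=.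
  by apply/andP; split; apply/eqP; ring.
have ec : map_mx Num.conj z = f x - 'i%C *: f y.
  apply/matrixP => i j; rewrite !mxE conjcE; apply/eqP; rewrite eq_complex /=.
  by apply/andP; split; apply/eqP; ring.
have e u M v : bilin (f u) (mxC M) (f v) = (dot u (M *m v))%:C%C.
  by rewrite /bilin /f matrix.map_trmx -!map_mxM mxE /dot mulmxA.
rewrite -/(bilin _ _ _) (bilin_expand _ _ ec ez) !e.
by apply/eqP; rewrite eq_complex /=; apply/andP; split; apply/eqP; ring.
Qed.

Lemma qcm_uncert n (Om V : 'M[R]_n) : Om^T = - Om -> qcm Om V <-> uncert Om V.
Proof.
move=> sO; rewrite /qcm /uncert; split=> -[sV h]; split=> //.
  move=> x y; have := h (\matrix_(i, j) (x i j +i* y i j)%C).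
  rewrite hermitian_form lecE /= => /andP[_].
  by rewrite [dot y (Om *m x)]dotC dot_mull sO mulNmx dotNr; lra.
move=> z; pose x := map_mx (@complex.Re R) z; pose y := map_mx (@complex.Im R) z.
have -> : z = \matrix_(i, j) (x i j +i* y i j)%C.
  by apply/matrixP => i j; rewrite !mxE; case: (z i j).
rewrite hermitian_form lecE /=; apply/andP; split; last first.
  have := h x y; rewrite [dot y (Om *m x)]dotC dot_mull sO mulNmx dotNr; lra.
have e u : dot u (Om *m u) = 0.
  have : dot u (Om *m u) = - dot u (Om *m u).
    by rewrite -dotNr -mulNmx -sO -dot_mull dotC.
  lra.
rewrite !e [dot y (V *m x)]dotC dot_mull sV; apply/eqP; lra.
Qed.

Lemma loewner_psd n (M N : 'M[R]_n) : M^T = M -> N^T = N ->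
  loewner_le (mxC M) (mxC N) <-> psd (N - M).
Proof.
move=> sM sN.
have e : mxC N - mxC M = mxC (N - M) - 'i%C *: mxC 0.
  apply/matrixP => i j; rewrite !mxE; apply/eqP; rewrite eq_complex /=.
  by apply/andP; split; apply/eqP; ring.
(* The Loewner order is the uncertainty relation for the zero form. *)
have q : qcm 0 (N - M) <-> uncert 0 (N - M).
  by apply: qcm_uncert; rewrite trmx0 oppr0.
rewrite /loewner_le e; split=> [h | [s h]].
  by apply: uncert_psd (q.1 (conj _ h)); rewrite linearB /= sM sN.
suff /q[] : uncert 0 (N - M) by [].
split=> // x y.
by rewrite mul0mx (dotC x 0) dot0l mulr0 addr0 addr_ge0.
Qed.

End ComplexForms.

(** * Entanglement of framed states *)

Section Entropies.
Context {R : realType}.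

Lemma symp_Omega m : symp_form (Omega m : 'M[R]_(m + m)).
Proof. exact: symp_std. Qed.

Lemma symp_OmegaAB a b : symp_form (OmegaAB a b : 'M[R]_((a + a) + (b + b))).
Proof. exact: symp_form_bdiag (symp_Omega a) (symp_Omega b). Qed.

Lemma symp_OmegaABE a b e :
  symp_form (OmegaABE a b e : 'M[R]_(((a + a) + (b + b)) + (e + e))).
Proof. exact: symp_form_bdiag (symp_OmegaAB a b) (symp_Omega e). Qed.

(** The Schur complements of the AE and BE blocks are principal blocks of that of [W], so the
    determinants on E cancel. *)
Lemma cond_mutual_infoE n1 n2 n3 (W : 'M[R]_((n1 + n2) + n3)) : pd W ->
  cond_mutual_info W = 2^-1 * log2 (mi_ratio (schur W)).
Proof.
move=> pW; have pE := pd_dr pW; have pS := pd_schur pW.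
have eA : \det (blockAE W) = \det (drsubmx W) * \det (ulsubmx (schur W)).
  rewrite det_schur /blockAE block_mxKdr ?pE.2 // schur_block ulsubmxB.
  by rewrite mul_usub_mx mulmx_lsub mul_usub_mx.
have eB : \det (blockBE W) = \det (drsubmx W) * \det (drsubmx (schur W)).
  rewrite det_schur /blockBE block_mxKdr ?pE.2 // schur_block drsubmxB.
  by rewrite mul_dsub_mx mulmx_rsub mul_dsub_mx.
congr (_ * log2 _); rewrite eA eB /mi_ratio (det_schur pE.2).
have [d1 d2] := (pd_det_gt0 pE, pd_det_gt0 pS).
by field; rewrite !gt_eqF.
Qed.

Lemma half_log2_le (x y eta : R) N : 0 < x -> 0 < y -> 0 < eta ->
  x <= ((1 + eta) ^+ 2) ^+ N * y ->
  2^-1 * log2 x <= 2^-1 * log2 y + N%:R * eta / ln 2.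
Proof.
move=> x0 y0 eta0 h; have l2 : 0 < ln (2 : R) by rewrite ln_gt0 ?ltr1n.
have e1 : 0 < 1 + eta by lra.
have : ln x <= (2 * N)%:R * eta + ln y.
  apply: (@le_trans _ _ (ln (((1 + eta) ^+ 2) ^+ N * y))).
    by rewrite ler_ln ?posrE ?mulr_gt0 ?exprn_gt0.
  rewrite -exprM lnM ?posrE ?exprn_gt0 // lerD2r lnXn // -[ln _ *+ _]mulr_natl.
  by rewrite ler_wpM2l // le_ln1Dx //; lra.
rewrite /log2 natrM => h1.
rewrite (_ : 2^-1 * (ln y / ln 2) + _ = 2^-1 * ((2%:R * N%:R * eta + ln y) / ln 2)); last first.
  by field; rewrite gt_eqF.
by rewrite ler_pM2l ?invr_gt0 // ler_pM2r ?invr_gt0.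
Qed.

Lemma lee_eta (x y : \bar R) N :
  (forall eta : R, 0 < eta -> (x <= y + (N%:R * eta / ln 2)%:E)%E) -> (x <= y)%E.
Proof.
move=> h; apply/lee_addgt0Pr => d d0.
have l2 : 0 < ln (2 : R) by rewrite ln_gt0 ?ltr1n.
have N1 : 0 < N%:R + 1 :> R by rewrite ltr_wpDl.
(* [N + 1] rather than [N], which may be zero. *)
have eta0 : 0 < d * ln 2 / (N%:R + 1) by rewrite divr_gt0 // mulr_gt0.
apply: le_trans (h _ eta0) _; rewrite leeD2l // lee_fin.
rewrite (_ : _ / ln 2 = d * (N%:R / (N%:R + 1))); last by field; rewrite !gt_eqF.
by rewrite ler_piMr ?ltW // ltr_pdivrMr // mul1r ltrDl.
Qed.

Lemma half_log2_ge0 (x : R) : 1 <= x -> 0 <= 2^-1 * log2 x.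
Proof.
move=> x1; rewrite mulr_ge0 // divr_ge0 ?ln_ge0 //.
by rewrite ler1n.
Qed.

(* By the theorem this is the common value of the three entanglement measures
   of a state whose local blocks in some [xp]-coordinates are [Q] and [P]. *)
Definition xp_value a b (Q P : 'M[R]_(a + b)) : \bar R :=
  ereal_inf [set (2^-1 * log2 (mi_ratio K))%:E | K in between Q P].

Definition xp_framed a b (TA NA : 'M[R]_(a, a + a)) (TB NB : 'M[R]_(b, b + b))
    (V : 'M[R]_((a + a) + (b + b))) : Prop :=
  [/\ frame (Omega a) TA NA, frame (Omega b) TB NB, uncert (OmegaAB a b) V &
      block_mx TA 0 0 TB *m V *m (block_mx NA 0 0 NB)^T = 0].

Section XpFramed.
Context {a b : nat} {TA NA : 'M[R]_(a, a + a)} {TB NB : 'M[R]_(b, b + b)}.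
Context {V : 'M[R]_((a + a) + (b + b))}.
Hypothesis hV : xp_framed TA NA TB NB V.

Local Notation T := (block_mx TA 0 0 TB).
Local Notation N := (block_mx NA 0 0 NB).
Local Notation Q := (T *m V *m T^T).
Local Notation P := (N *m V *m N^T).

Let hFA : frame (Omega a) TA NA. Proof. by case: hV. Qed.
Let hFB : frame (Omega b) TB NB. Proof. by case: hV. Qed.
Let uV : uncert (OmegaAB a b) V. Proof. by case: hV. Qed.
Let hTN : T *m V *m N^T = 0. Proof. by case: hV. Qed.
Let hF : frame (OmegaAB a b) T N. Proof. exact: frame_bdiag hFA hFB. Qed.

Lemma frame_between : between Q P Q.
Proof.
split; [|exact: psd_eq0|exact (frame_uncert (symp_OmegaAB a b) hF uV)].
exact (frame_pd hF (uncert_pd (symp_OmegaAB a b) uV)).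
Qed.

Lemma renyi2_le_xp_value : (renyi2_ent_formation V <= xp_value Q P)%E.
Proof.
have hO := symp_OmegaAB a b.
apply: le_ereal_inf_tmp => _ [K [pK hQ hP] <-].
apply: ereal_inf_lbound; exists (xpstate (OmegaAB a b) T N K (invmx K)).
  have [pst est] := st_pure hO hF pK; have [ust dst] := pure_uncert hO pst est.
  split; first by split=> //; apply/qcm_uncert => //; exact: (proj1 hO).
  apply/loewner_psd; [exact: pst.1 | exact: uV.1 |].
  rewrite [X in X - _](xpstate_of hO hF uV.1 hTN); exact: st_mono.
by rewrite det_xpstate_ul.
Qed.

(** Existence is what makes the [get] in [intrinsic_ent] return the value of a purification. *)
Lemma purification_ex : exists e (g : 'M[R]_(((a + a) + (b + b)) + (e + e))),
  purification V g.
Proof.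
have [g [pg gOg <-]] := purification_frame (symp_OmegaAB a b) (symp_Omega (a + b))
  hF (frame_std (a + b)) uV hTN.
exists (a + b)%N, g; split=> //.
have [ug dg] := pure_uncert (symp_OmegaABE a b (a + b)) pg gOg.
by split=> //; apply/qcm_uncert => //; exact: (proj1 (symp_OmegaABE _ _ _)).
Qed.

Section Purification.
Context {e : nat} {g : 'M[R]_(((a + a) + (b + b)) + (e + e))}.
Hypothesis hg : purification V g.

Let hO := symp_OmegaABE a b e.
Let ug : uncert (OmegaABE a b e) g.
Proof. by apply/qcm_uncert; [exact: (proj1 hO) | case: hg => -[]]. Qed.
Let pg : pd g. Proof. exact: uncert_pd hO ug. Qed.
Let gOg : g *m OmegaABE a b e *m g = OmegaABE a b e.
Proof. by apply: uncert_pure => //; case: hg => -[]. Qed.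
Let gV : ulsubmx g = V. Proof. by case: hg. Qed.

Let cond_mi GA GB GE : uncert (Omega a) GA -> uncert (Omega b) GB -> uncert (Omega e) GE ->
  cond_mutual_info (g + dsum (dsum GA GB) GE) =
  2^-1 * log2 (mi_ratio (schur (g + block_mx 0 0 0 GE) + block_mx GA 0 0 GB)).
Proof.
move=> uA uB uE; rewrite cond_mutual_infoE; last first.
  apply: pdD => //; apply: psd_bdiag; last exact: uncert_psd uE.
  by apply: psd_bdiag; apply: uncert_psd; [exact: uA | exact: uB].
congr (_ * log2 (mi_ratio _)).
rewrite /dsum -[g]submxK !add_block_mx !schur_block !addr0; mxlin.
Qed.

Let conditioned GE : uncert (Omega e) GE ->
  let W := schur (g + block_mx 0 0 0 GE) in uncert (OmegaAB a b) W /\ psd (V - W).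
Proof.
move=> uE W; split; first exact: uncert_schur (symp_Omega e) ug uE.
have pE : pd (g + block_mx 0 0 0 GE).
  by apply: pdD => //; apply: psd_bdiag (psd0 _) (uncert_psd uE).
have := schur_le_ul (pd_sym pE) (pd_dr pE); rewrite -/W.
by rewrite -[in ulsubmx _](submxK g) add_block_mx block_mxKul addr0 gV.
Qed.

Lemma xp_value_le_intrinsic : (xp_value Q P <= intrinsic_value g)%E.
Proof.
apply: (@lee_eta _ _ (a + b)) => eta eta0.
have [GA [GB [uA uB hW]]] := homodyne_mi_ratio (symp_Omega a) (symp_Omega b) hFA hFB uV eta0.
have qA : qcm (Omega a) GA by apply/qcm_uncert => //; exact: (proj1 (symp_Omega a)).
have qB : qcm (Omega b) GB by apply/qcm_uncert => //; exact: (proj1 (symp_Omega b)).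
rewrite -leeBlDr //; apply: (@le_trans _ _ (ereal_inf
   [set (cond_mutual_info (g + dsum (dsum GA GB) GE))%:E | GE in qcm (Omega e)])).
  apply: le_ereal_inf_tmp => _ [GE /qcm_uncert-/(_ (proj1 (symp_Omega e))) uE <-].
  have [uW leW] := conditioned uE.
  have [hK hmi] := hW _ uW leW.
  rewrite leeBlDr // -EFinD cond_mi //.
  apply: (@le_trans _ _ (2^-1 * log2 (mi_ratio
     (T *m schur (g + block_mx 0 0 0 GE) *m T^T)))%:E).
    by apply: ereal_inf_lbound; exists (T *m schur (g + block_mx 0 0 0 GE) *m T^T).
  rewrite lee_fin; apply: half_log2_le => //; apply: lt_le_trans (mi_ratio_ge1 _) => //.
    by case: hK.
  apply: pdD; first exact: uncert_pd (symp_OmegaAB a b) uW.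
  by apply: psd_bdiag; apply: uncert_psd; [exact: uA | exact: uB].
apply: ereal_sup_ubound; exists GA => //; exists GB => //.
Qed.

Lemma intrinsic_le_renyi2 : (intrinsic_value g <= renyi2_ent_formation V)%E.
Proof.
apply: le_ereal_inf_tmp => _ [G [[qG dG] leG] <-].
have hOAB := symp_OmegaAB a b.
have uG : uncert (OmegaAB a b) G by apply/qcm_uncert => //; exact: (proj1 hOAB).
have pG := uncert_pd hOAB uG; have GOG := uncert_pure hOAB uG dG.
have {}leG : psd (ulsubmx g - G).
  by rewrite gV; apply/loewner_psd => //; [exact: uG.1 | exact: uV.1].
apply: ge_ereal_sup => _ [GA qA [GB qB <-]].
have uA : uncert (Omega a) GA by apply/qcm_uncert => //; exact: (proj1 (symp_Omega a)).
have uB : uncert (Omega b) GB by apply/qcm_uncert => //; exact: (proj1 (symp_Omega b)).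
apply: (@lee_eta _ _ ((a + a) + (b + b))) => eta eta0.
have [GE [uE hi lo]] := steering_near hOAB (symp_Omega e) pg gOg pG GOG leG eta0.
apply: (@le_trans _ _ (cond_mutual_info (g + dsum (dsum GA GB) GE))%:E).
  apply: ereal_inf_lbound; exists GE => //.
  by apply/qcm_uncert => //; exact: (proj1 (symp_Omega e)).
rewrite cond_mi // -EFinD lee_fin.
have [uW leW] := conditioned uE.
set W := schur _ in hi lo uW leW *.
have pGam : psd (block_mx GA 0 0 GB).
  by apply: psd_bdiag; apply: uncert_psd; [exact: uA | exact: uB].
have pW1 : pd (W + block_mx GA 0 0 GB) by apply: pdD => //; exact: uncert_pd hOAB uW.
have pG1 : pd (G + block_mx GA 0 0 GB) by apply: pdD.
have e1 : 0 < 1 + eta by lra.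
have i1 : (1 + eta)^-1 <= 1 by rewrite invf_le1 //; lra.
(* The noise is common to both states, so the two-sided comparison of [W] with [G] carries over. *)
have h1 : mi_ratio (W + block_mx GA 0 0 GB) <=
    ((1 + eta) / (1 + eta)^-1) ^+ ((a + a) + (b + b)) * mi_ratio (G + block_mx GA 0 0 GB).
  apply: mi_ratio_sandwich => //; first by rewrite invr_gt0.
    rewrite scalerDr (_ : _ - _ = (W - (1 + eta)^-1 *: G)
       + (1 - (1 + eta)^-1) *: block_mx GA 0 0 GB); last by mxlin.
    by apply: psdD => //; apply: psdZ => //; rewrite subr_ge0.
  rewrite scalerDr (_ : _ - _ = ((1 + eta) *: G - W)
     + eta *: block_mx GA 0 0 GB); last by mxlin.
  by apply: psdD => //; apply: psdZ => //; exact: ltW.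
apply: half_log2_le => //.
- by apply: lt_le_trans (mi_ratio_ge1 pW1).
- exact: pd_det_gt0 (pd_ul pG).
apply: le_trans h1 _; rewrite invrK -expr2 ler_pM2l ?exprn_gt0 //.
exact: pure_mi_ratio (symp_Omega a) (symp_Omega b) pG GOG uA uB.
Qed.

End Purification.

Lemma xp_framed_values :
  intrinsic_ent V = xp_value Q P /\ renyi2_ent_formation V = xp_value Q P.
Proof.
have key e (g : 'M[R]_(((a + a) + (b + b)) + (e + e))) : purification V g ->
    intrinsic_value g = xp_value Q P /\ renyi2_ent_formation V = xp_value Q P.
  move=> hg; have h1 := xp_value_le_intrinsic hg; have h2 := intrinsic_le_renyi2 hg.
  have h3 := renyi2_le_xp_value.
  by split; apply: le_anti; apply/andP; split=> //; [exact: le_trans h2 h3 | exact: le_trans h1 h2].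
have [e [g hg]] := purification_ex.
split; last by case: (key _ _ hg).
rewrite /intrinsic_ent; set S := [set x | _].
have [e' [g' [hg' ->]]] : S (get S).
  by apply: getPex; exists (intrinsic_value g), e, g.
by case: (key _ _ hg').
Qed.

End XpFramed.

End Entropies.

(** * Copies *)

Section Copies.
Context {R : realType}.

Lemma xp_value_ge0 a b (Q P : 'M[R]_(a + b)) : (0 <= xp_value Q P)%E.
Proof.
apply: le_ereal_inf_tmp => _ [K [pK _ _] <-].
by rewrite lee_fin half_log2_ge0 // mi_ratio_ge1.
Qed.

Lemma xp_value_fin a b (Q P K : 'M[R]_(a + b)) : between Q P K ->
  exists r : R, xp_value Q P = r%:E.
Proof.
move=> hK; have h0 := xp_value_ge0 Q P.
have : (xp_value Q P <= (2^-1 * log2 (mi_ratio K))%:E)%E.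
  by apply: ereal_inf_lbound; exists K.
by case: (xp_value Q P) h0 => [r||] // _ _; exists r.
Qed.

Lemma half_log2M (x y : R) : 1 <= x -> 1 <= y ->
  2^-1 * log2 (x * y) = 2^-1 * log2 x + 2^-1 * log2 y.
Proof.
move=> x1 y1; rewrite /log2 lnM ?posrE; [ring|lra|lra].
Qed.

Lemma xp_value_bsum a1 b1 a2 b2 (Q1 P1 K1 : 'M[R]_(a1 + b1)) (Q2 P2 K2 : 'M[R]_(a2 + b2)) :
  between Q1 P1 K1 -> between Q2 P2 K2 ->
  xp_value (bsum Q1 Q2) (bsum P1 P2) = (xp_value Q1 P1 + xp_value Q2 P2)%E.
Proof.
move=> h1 h2; have [r1 e1] := xp_value_fin h1; have [r2 e2] := xp_value_fin h2.
have [hb _] := bsum_between h1 h2; have [rb eb] := xp_value_fin hb.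
have lb a b (Q P K : 'M[R]_(a + b)) r : xp_value Q P = r%:E -> between Q P K ->
    r <= 2^-1 * log2 (mi_ratio K).
  by move=> e hK; rewrite -lee_fin -e; apply: ereal_inf_lbound; exists K.
have glb a b (Q P : 'M[R]_(a + b)) r x : xp_value Q P = r%:E ->
    (forall K, between Q P K -> x <= 2^-1 * log2 (mi_ratio K)) -> x <= r.
  move=> e hx; rewrite -lee_fin -e; apply: le_ereal_inf_tmp => _ [K hK <-].
  by rewrite lee_fin; apply: hx.
rewrite eb e1 e2 -EFinD; congr _%:E; apply/eqP; rewrite eq_le; apply/andP; split.
  rewrite -lerBlDl; apply: (glb _ _ _ _ _ _ e2) => K hK.
  rewrite lerBlDr -lerBlDl; apply: (glb _ _ _ _ _ _ e1) => K' hK'.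
  rewrite lerBlDl addrC; have [hKK eKK] := bsum_between hK' hK.
  have := lb _ _ _ _ _ _ eb hKK; rewrite eKK half_log2M // mi_ratio_ge1 //.
    by case: hK'.
  by case: hK.
apply: (glb _ _ _ _ _ _ eb) => K /between_bsum[K1' [K2' [h1' h2' le]]].
apply: (le_trans (lerD (lb _ _ _ _ _ _ e1 h1') (lb _ _ _ _ _ _ e2 h2'))).
have [p1 p2] : pd K1' /\ pd K2' by case: h1'; case: h2'.
have [m1 m2] := (mi_ratio_ge1 p1, mi_ratio_ge1 p2).
rewrite -half_log2M // ler_pM2l ?invr_gt0 // /log2 ler_pM2r ?invr_gt0 ?ln_gt0 ?ltr1n //.
have m0 : 0 < mi_ratio K1' * mi_ratio K2' by rewrite mulr_gt0 //; lra.
by rewrite ler_ln ?posrE // (lt_le_trans m0).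
Qed.

Definition rep n p q (M : 'M[R]_(p, q)) : 'M[R]_(n * p, n * q) := (1%:M : 'M[R]_n) *t M.

Lemma repM n p q r (A : 'M[R]_(p, q)) (B : 'M[R]_(q, r)) :
  rep n (A *m B) = rep n A *m rep n B.
Proof. by rewrite /rep tensmx_mul mul1mx. Qed.

Lemma rep_tr n p q (A : 'M[R]_(p, q)) : (rep n A)^T = rep n A^T.
Proof. by rewrite /rep trmx_tens trmx1. Qed.

Lemma repD n p q (A B : 'M[R]_(p, q)) : rep n (A + B) = rep n A + rep n B.
Proof. by apply/matrixP => i j; rewrite !mxE mulrDr. Qed.

Lemma repN n p q (A : 'M[R]_(p, q)) : rep n (- A) = - rep n A.
Proof. by apply/matrixP => i j; rewrite !mxE mulrN. Qed.

Lemma rep0 n p q : rep n (0 : 'M[R]_(p, q)) = 0.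
Proof. exact: tensmx0. Qed.

Lemma rep1 n p : rep n (1%:M : 'M[R]_p) = 1%:M.
Proof.
apply/matrixP => i j.
case: (mxtens_indexP i) => i0 i1; case: (mxtens_indexP j) => j0 j1.
by rewrite tensmxE !mxE -natrM mulnb (inj_eq (can_inj (@mxtens_indexK n p))) xpair_eqE.
Qed.

(** The statement typechecks because [n.+1 * p] converts to [p + n * p]; it isolates one copy for
    induction. *)
Lemma repS n p q (M : 'M[R]_(p, q)) :
  rep n.+1 M = block_mx M 0 0 (rep n M) :> 'M[R]_(p + n * p, q + n * q).
Proof.
have el m (i : 'I_m) : lshift (n * m) i = mxtens_index (ord0 : 'I_n.+1, i).
  by apply: val_inj.
have er m (i : 'I_n) (k : 'I_m) :
    rshift m (mxtens_index (i, k)) = mxtens_index (lift ord0 i, k).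
  by apply: val_inj; rewrite /= /bump /= add1n mulSn addnA.
rewrite /rep; apply/matrixP => i j.
case: (split_ordP i) => i' ->; case: (split_ordP j) => j' ->.
- by rewrite block_mxEul !el; apply: (etrans (tensmxE _ _ _ _ _ _)); rewrite mxE mul1r.
- case: (mxtens_indexP j') => j0 j1.
  by rewrite block_mxEur el er; apply: (etrans (tensmxE _ _ _ _ _ _)); rewrite !mxE mul0r.
- case: (mxtens_indexP i') => i0 i1.
  by rewrite block_mxEdl el er; apply: (etrans (tensmxE _ _ _ _ _ _)); rewrite !mxE mul0r.
- case: (mxtens_indexP i') => i0 i1; case: (mxtens_indexP j') => j0 j1.
  rewrite block_mxEdr !er tensmxE; apply: (etrans (tensmxE _ _ _ _ _ _)).
  by rewrite !mxE (inj_eq lift_inj).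
Qed.

Definition brep n p1 p2 q1 q2 (M : 'M[R]_(p1 + p2, q1 + q2)) :
    'M[R]_(n * p1 + n * p2, n * q1 + n * q2) :=
  block_mx (rep n (ulsubmx M)) (rep n (ursubmx M)) (rep n (dlsubmx M)) (rep n (drsubmx M)).

Lemma brepM n p1 p2 q1 q2 r1 r2 (A : 'M[R]_(p1 + p2, q1 + q2)) (B : 'M[R]_(q1 + q2, r1 + r2)) :
  brep n (A *m B) = brep n A *m brep n B.
Proof.
rewrite -[A in LHS]submxK -[B in LHS]submxK mulmx_block /brep.
rewrite block_mxKul block_mxKur block_mxKdl block_mxKdr mulmx_block.
by rewrite !repD !repM.
Qed.

Lemma brep_tr n p1 p2 q1 q2 (A : 'M[R]_(p1 + p2, q1 + q2)) : (brep n A)^T = brep n A^T.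
Proof.
by rewrite /brep tr_block_mx !rep_tr trmx_ulsub trmx_ursub trmx_dlsub trmx_drsub.
Qed.

Lemma brepB n p1 p2 q1 q2 (A B : 'M[R]_(p1 + p2, q1 + q2)) :
  brep n (A - B) = brep n A - brep n B.
Proof.
rewrite /brep ulsubmxB ursubmxB drsubmxB.
have -> : dlsubmx (A - B) = dlsubmx A - dlsubmx B by apply/matrixP => i j; rewrite !mxE.
by rewrite !repD !repN opp_block_mx add_block_mx.
Qed.

Lemma brep1 n p1 p2 : brep n (1%:M : 'M[R]_(p1 + p2)) = 1%:M.
Proof.
rewrite (scalar_mx_block p1 p2) /brep block_mxKul block_mxKur block_mxKdl block_mxKdr.
by rewrite !rep1 !rep0 -scalar_mx_block.
Qed.

Lemma brep0 n p1 p2 q1 q2 : brep n (0 : 'M[R]_(p1 + p2, q1 + q2)) = 0.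
Proof.
rewrite -[0 in LHS]block_mx0 /brep block_mxKul block_mxKur block_mxKdl block_mxKdr.
by rewrite !rep0 block_mx0.
Qed.

Lemma brep_psd n p1 p2 (M : 'M[R]_(p1 + p2)) : psd M -> psd (brep n M).
Proof. by move=> /psd_factor[L ->]; rewrite brepM -brep_tr; apply: psd_gram. Qed.

Lemma brep_inv n p1 p2 (M : 'M[R]_(p1 + p2)) : M \in unitmx ->
  brep n M \in unitmx /\ invmx (brep n M) = brep n (invmx M).
Proof.
move=> uM; have e : brep n M *m brep n (invmx M) = 1%:M.
  by rewrite -brepM mulmxV // brep1.
have [u _] := mulmx1_unit e; split=> //.
by rewrite -[LHS]mulmx1 -e mulKmx.
Qed.

Lemma brep_between n p1 p2 (Q P K : 'M[R]_(p1 + p2)) :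
  between Q P K -> between (brep n Q) (brep n P) (brep n K).
Proof.
move=> [pK hQ hP]; have [u e] := brep_inv n pK.2.
by split; [split=> //; exact: brep_psd (proj1 pK) | |]; rewrite ?e -brepB; apply: brep_psd.
Qed.

Lemma brepS n a b (Q : 'M[R]_(a + b)) : brep n.+1 Q = bsum Q (brep n Q).
Proof.
by rewrite /brep !repS /bsum block_mxKul block_mxKur block_mxKdl block_mxKdr.
Qed.

Lemma xp_value_brep n a b (Q P K : 'M[R]_(a + b)) r : between Q P K ->
  xp_value Q P = r%:E -> xp_value (brep n Q) (brep n P) = (n%:R * r)%:E.
Proof.
move=> hK e; elim: n => [|n IH].
  (* For zero copies the determinants are empty and the value is 0. *)
  have h0 := brep_between 0 hK.
  have [s es] := xp_value_fin h0.
  rewrite mul0r; apply: le_anti; rewrite xp_value_ge0 andbT.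
  apply: ge_ereal_inf; exists (0 : R)%:E => //.
  exists (brep 0 K) => //; rewrite /mi_ratio !det_mx00 mul1r divr1 /log2 ln1.
  by rewrite mul0r mulr0.
rewrite !brepS (xp_value_bsum hK (brep_between n hK)) e IH -EFinD.
by congr _%:E; rewrite -natr1; ring.
Qed.

(** The positions of all copies precede all momenta, so the two column blocks of a frame are
    repeated separately. *)
Definition rowrep n p q (M : 'M[R]_(p, q + q)) : 'M[R]_(n * p, n * q + n * q) :=
  row_mx (rep n (lsubmx M)) (rep n (rsubmx M)).

Lemma rowrep_form n p q1 q2 r (A : 'M[R]_(p, q1 + q1)) (B : 'M[R]_(r, q2 + q2)) M :
  rowrep n A *m copies_block n M *m (rowrep n B)^T = rep n (A *m M *m B^T).
Proof.
rewrite /rowrep /copies_block -!/(rep n _) mul_row_block tr_row_mx mul_row_col !rep_tr.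
rewrite -[A in RHS]hsubmxK -[B in RHS]hsubmxK -[M in RHS]submxK.
rewrite mul_row_block tr_row_mx mul_row_col.
by rewrite !(repD, repM).
Qed.

Lemma rowrep_antisym n p q1 q2 (A C : 'M[R]_(p, q1 + q1)) (B D : 'M[R]_(p, q2 + q2)) :
  (rowrep n A)^T *m rowrep n B - (rowrep n C)^T *m rowrep n D
  = copies_block n (A^T *m B - C^T *m D).
Proof.
have e (X : 'M[R]_(p, q1 + q1)) (Y : 'M[R]_(p, q2 + q2)) :
    (rowrep n X)^T *m rowrep n Y = brep n (X^T *m Y).
  rewrite /rowrep tr_row_mx mul_col_row !rep_tr -!repM.
  rewrite -[X in RHS]hsubmxK -[Y in RHS]hsubmxK tr_row_mx mul_col_row.
  by rewrite /brep block_mxKul block_mxKur block_mxKdl block_mxKdr.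
by rewrite !e -brepB.
Qed.

Lemma copies_Omega n m : copies_block n (Omega m) = Omega (n * m) :> 'M[R]_(_).
Proof.
rewrite /copies_block /Omega block_mxKul block_mxKur block_mxKdl block_mxKdr.
rewrite -!/(rep n _).
by rewrite repN !rep0 !rep1.
Qed.

Lemma rowrep_frame n a (T N : 'M[R]_(a, a + a)) : frame (Omega a) T N ->
  frame (Omega (n * a)) (rowrep n T) (rowrep n N).
Proof.
move=> [h1 h2 h3 h4].
split; rewrite -copies_Omega.
- by rewrite rowrep_form h1 rep0.
- by rewrite rowrep_form h2 rep0.
- by rewrite rowrep_form h3 rep1.
- by rewrite rowrep_antisym h4.
Qed.

Lemma copies_form n a b (TA NA : 'M[R]_(a, a + a)) (TB NB : 'M[R]_(b, b + b)) V :
  block_mx (rowrep n TA) 0 0 (rowrep n TB) *m copies n V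
    *m (block_mx (rowrep n NA) 0 0 (rowrep n NB))^T
  = brep n (block_mx TA 0 0 TB *m V *m (block_mx NA 0 0 NB)^T).
Proof.
rewrite !bdiag_cong /brep block_mxKul block_mxKur block_mxKdl block_mxKdr.
rewrite /copies block_mxKul block_mxKur block_mxKdl block_mxKdr.
by rewrite !rowrep_form.
Qed.

Lemma xp_framed_copies n a b (TA NA : 'M[R]_(a, a + a)) (TB NB : 'M[R]_(b, b + b)) V :
  xp_framed TA NA TB NB V ->
  xp_framed (rowrep n TA) (rowrep n NA) (rowrep n TB) (rowrep n NB) (copies n V).
Proof.
move=> hV; have [hA hB uV hTN] := hV; have [pQ _ hP] := frame_between hV.
have hAn := rowrep_frame n hA; have hBn := rowrep_frame n hB.
have hO := symp_OmegaAB (R := R) (n * a) (n * b).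
have hF : frame (OmegaAB (n * a) (n * b)) _ _ := frame_bdiag hAn hBn.
split=> //; last by rewrite copies_form hTN brep0.
have sV : (copies n V)^T = copies n V.
  have tr p q (M : 'M[R]_(p + p, q + q)) : (copies_block n M)^T = copies_block n M^T.
    exact: brep_tr.
  by rewrite /copies tr_block_mx !tr trmx_ulsub trmx_ursub trmx_dlsub trmx_drsub uV.1.
rewrite (xpstate_of hO hF sV); last by rewrite copies_form hTN brep0.
rewrite !copies_form.
(* The copies inherit the uncertainty relation from the pure state with blocks [brep n Q] and its
   inverse, which lies below them. *)
have [pQn hQn hPn] := brep_between n (frame_between hV).
have [h1 h2] := st_pure hO hF pQn; have [u _] := pure_uncert hO h1 h2.
apply: uncert_mono u _; apply: st_mono => //; exact: psd_eq0.
Qed.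

End Copies.

(** * One mode per party *)

Section TwoModes.
Context {R : realType}.

Definition mat2 (a b c d : R) : 'M[R]_(1 + 1) := block_mx a%:M b%:M c%:M d%:M.

Lemma mat2P (M : 'M[R]_(1 + 1)) : exists a b c d, M = mat2 a b c d.
Proof.
exists (ulsubmx M 0 0), (ursubmx M 0 0), (dlsubmx M 0 0), (drsubmx M 0 0).
by rewrite /mat2 -!mx11_scalar submxK.
Qed.

Lemma mat2M a b c d p q r s : mat2 a b c d *m mat2 p q r s
  = mat2 (a * p + b * r) (a * q + b * s) (c * p + d * r) (c * q + d * s).
Proof. by rewrite /mat2 mulmx_block -!scalar_mxM -!raddfD. Qed.

Lemma mat2_tr a b c d : (mat2 a b c d)^T = mat2 a c b d.
Proof. by rewrite /mat2 tr_block_mx !tr_scalar_mx. Qed.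

Lemma mat2_no_xp a d : no_xp_entries (mat2 a 0 0 d).
Proof. by split; rewrite /mat2 ?block_mxKur ?block_mxKdl raddf0. Qed.

Lemma mat2_symplectic a b c d : a * d - b * c = 1 -> symplectic (Omega 1) (mat2 a b c d).
Proof.
move=> h; have -> : Omega 1 = mat2 0 1 (-1) 0 :> 'M[R]_(1 + 1).
  by rewrite /Omega /mat2 !raddf0 raddfN.
rewrite /symplectic mat2_tr !mat2M; congr mat2; lra.
Qed.

Lemma symplecticM n (Om S T : 'M[R]_n) :
  symplectic Om S -> symplectic Om T -> symplectic Om (S *m T).
Proof.
rewrite /symplectic => hS hT.
by rewrite trmx_mul !mulmxA -[S *m T *m Om]mulmxA -[S *m _ *m T^T]mulmxA hT.
Qed.

Lemma williamson1 (A : 'M[R]_(1 + 1)) : pd A ->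
  exists S d, symplectic (Omega 1) S /\ S *m A *m S^T = mat2 d 0 0 d.
Proof.
move=> pA; have [p [q [q' [r eA]]]] := mat2P A.
have := pd_det_gt0 (pd_dr pA); have := pd_det_gt0 (pd_schur pA).
have : q' = q.
  have := pd_sym pA; rewrite eA mat2_tr => /eq_block_mx[_ /matrixP/(_ 0 0)].
  by rewrite !mxE !mulr1n.
move=> eq; rewrite eA eq /mat2 schur_block block_mxKdr invmx_scalar -!scalar_mxM -raddfB.
rewrite !det_scalar !expr1 /=; set s := p - q / r * q => s0 r0.
(* The shear in [S] leaves [diag(s, r)]; scaling the rows by [al] and [al^-1] makes both entries
   [sqrt (r s)]. *)
pose k := Num.sqrt (r / s); pose al := Num.sqrt k.
have k0 : 0 < k by rewrite sqrtr_gt0 divr_gt0.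
have al0 : 0 < al by rewrite sqrtr_gt0.
have ak : al * al = k by rewrite -expr2 sqr_sqrtr // ltW.
have kk : k * k = r / s by rewrite -expr2 sqr_sqrtr // divr_ge0 // ltW.
exists (mat2 al (- al * q / r) 0 al^-1), (k * s); split.
  by apply: mat2_symplectic; field; rewrite !gt_eqF.
rewrite -/(mat2 p q q r) mat2_tr !mat2M; congr mat2.
- by rewrite -ak /s; field; rewrite !gt_eqF.
- by field; rewrite !gt_eqF.
- by field; rewrite !gt_eqF.
have -> : k * s = r / k.
  have sn : s != 0 by rewrite gt_eqF.
  have kn : k != 0 by rewrite gt_eqF.
  apply: (mulIf kn); rewrite mulfVK // mulrAC kk mulfVK //.
by rewrite -ak; field; rewrite !gt_eqF.
Qed.

Lemma phase_ex (x y : R) : exists t, x * sin t + y * cos t = 0.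
Proof.
have [->|x0] := eqVneq x 0.
  by exists (pi / 2); rewrite cos_pihalf mul0r mulr0 addr0.
exists (atan (- y / x)).
have c0 : cos (atan (- y / x)) != 0 by rewrite gt_eqF // cos_gt0_pihalf // atan_gtNpi2 atan_ltpi2.
have := atanK (- y / x); rewrite /tan => e.
have -> : sin (atan (- y / x)) = - y / x * cos (atan (- y / x)) by rewrite -{2}e mulfVK.
by field.
Qed.

Definition rot (t : R) := mat2 (cos t) (- sin t) (sin t) (cos t).

Lemma rot_symplectic t : symplectic (Omega 1) (rot t).
Proof. by apply: mat2_symplectic; rewrite -(cos2Dsin2 t); ring. Qed.

Lemma rot_scalar t d : rot t *m mat2 d 0 0 d *m (rot t)^T = mat2 d 0 0 d.
Proof.
rewrite mat2_tr !mat2M; have e := cos2Dsin2 t.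
by congr mat2; [|ring|ring|]; rewrite -[RHS]mulr1 -e; ring.
Qed.

(* The off-diagonal entries of [rot s *m C *m (rot t)^T] have sum and
   difference depending only on [s + t] and [t - s]. *)
Lemma rot_diag (C : 'M[R]_(1 + 1)) :
  exists s t x y, rot s *m C *m (rot t)^T = mat2 x 0 0 y.
Proof.
have [c11 [c12 [c21 [c22 ->]]]] := mat2P C.
have [t1 h1] := phase_ex (c11 - c22) (c12 + c21).
have [t2 h2] := phase_ex (c11 + c22) (c12 - c21).
pose s := (t1 - t2) / 2; pose t := (t1 + t2) / 2.
have e1 : t1 = s + t by rewrite /s /t; field.
have e2 : t2 = t - s by rewrite /s /t; field.
move: h1 h2; rewrite e1 e2 sinD cosD sinB cosB => h1 h2.
exists s, t; rewrite mat2_tr !mat2M.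
do 2 eexists; congr mat2; lra.
Qed.

Lemma two_mode_normal (V : 'M[R]_((1 + 1) + (1 + 1))) :
  qcm (OmegaAB 1 1) V -> normal_qcm V.
Proof.
move=> qV; split=> //.
have hO := symp_OmegaAB (R := R) 1 1.
have uV : uncert (OmegaAB 1 1) V by apply/qcm_uncert => //; exact: (proj1 hO).
have pV := uncert_pd hO uV.
have [SA [dA [sA eA]]] := williamson1 (pd_ul pV).
have [SB [dB [sB eB]]] := williamson1 (pd_dr pV).
have [s [t [x [y eC]]]] := rot_diag (SA *m ursubmx V *m SB^T).
have e (S T M : 'M[R]_(1 + 1)) u v : (rot u *m S) *m M *m (rot v *m T)^T
    = rot u *m (S *m M *m T^T) *m (rot v)^T.
  by rewrite trmx_mul !mulmxA.
exists (rot s *m SA), (rot t *m SB); split.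
- exact: symplecticM (rot_symplectic s) sA.
- exact: symplecticM (rot_symplectic t) sB.
rewrite /xp_form /dsum bdiag_cong block_mxKul block_mxKur block_mxKdl block_mxKdr.
have eC' : rot t *m (SB *m dlsubmx V *m SA^T) *m (rot s)^T = mat2 x 0 0 y.
  by rewrite -(sym_ur uV.1) -[RHS]mat2_tr -eC !trmx_mul !trmxK !mulmxA.
by rewrite !e eA eB eC eC' !rot_scalar; split; apply: mat2_no_xp.
Qed.

Lemma normal_framed a b (V : 'M[R]_((a + a) + (b + b))) : normal_qcm V ->
  exists TA NA TB NB, xp_framed TA NA TB NB V.
Proof.
move=> [qV [SA [SB [sA sB xpV]]]].
have uV : uncert (OmegaAB a b) V by apply/qcm_uncert => //; exact: (proj1 (symp_OmegaAB a b)).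
exists (row_mx 1%:M 0 *m SA), (row_mx 0 1%:M *m SA).
exists (row_mx 1%:M 0 *m SB), (row_mx 0 1%:M *m SB); split=> //.
- exact: frame_symp (symp_Omega a) sA (frame_std a).
- exact: frame_symp (symp_Omega b) sB (frame_std b).
have ur p q (M : 'M[R]_(p + p, q + q)) : no_xp_entries M ->
    row_mx 1%:M 0 *m M *m (row_mx 0 1%:M)^T = 0.
  move=> [h _]; rewrite -[M]submxK mul_row_block tr_row_mx mul_row_col !mx01E.
  exact: h.
have e p q (S : 'M[R]_(p + p)) (S' : 'M[R]_(q + q)) M :
    (row_mx 1%:M 0 *m S) *m M *m (row_mx 0 1%:M *m S')^T
    = row_mx 1%:M 0 *m (S *m M *m S'^T) *m (row_mx 0 1%:M)^T.
  by rewrite trmx_mul !mulmxA.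
move: xpV; rewrite /xp_form /dsum bdiag_cong block_mxKul block_mxKur block_mxKdl block_mxKdr.
by case=> h1 h2 h3 h4; rewrite bdiag_cong !e !ur // block_mx0.
Qed.

Lemma normal_values a b (V : 'M[R]_((a + a) + (b + b))) : normal_qcm V ->
  reg_intrinsic_ent V = intrinsic_ent V /\ intrinsic_ent V = renyi2_ent_formation V.
Proof.
move=> /normal_framed[TA [NA [TB [NB hV]]]].
have [e1 e2] := xp_framed_values hV; split; last by rewrite e1 e2.
have [r er] := xp_value_fin (frame_between hV).
rewrite e1 er /reg_intrinsic_ent.
set u := (fun n : nat => _).
have hu : u @ \oo --> r%:E.
  (* The sequence is constant from one copy on; at [n = 0] the factor [0^-1] is 0 by convention. *)
  apply: cvg_near_cst; exists 1%N => // n /= n1.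
  have [en _] := xp_framed_values (xp_framed_copies n hV).
  rewrite /u en !copies_form (xp_value_brep n (frame_between hV) er) -EFinM.
  by rewrite mulKf // pnatr_eq0 -lt0n.
rewrite is_cvg_limn_einfE; last by apply/cvg_ex; exists r%:E.
exact: cvg_lim.
Qed.

End TwoModes.

Theorem theorem7 (R : realType) :
  (forall (a b : nat) (V : 'M[R]_((a + a) + (b + b))),
     normal_qcm V ->
     reg_intrinsic_ent V = intrinsic_ent V /\
     intrinsic_ent V = renyi2_ent_formation V) /\
  (forall V : 'M[R]_((1 + 1) + (1 + 1)),
     qcm (OmegaAB 1 1) V ->
     reg_intrinsic_ent V = intrinsic_ent V /\
     intrinsic_ent V = renyi2_ent_formation V).
Proof.
by split=> [a b V|V /two_mode_normal]; exact: normal_values.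
Qed.
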